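(* Let $G$ be a (finite, loopless) multigraph of order $n \geq 3$ with at least one edge. Then $$\chi'(G) \leq \phi(G) + \log_{3/2}\bigl(\min\{n/3,\ \phi(G)\}\bigr) \quad \text{if } n \text{ is even},$$ and $$\chi'(G) \leq \phi(G) + \log_{3/2}\bigl(\min\{(n+1)/3,\ \phi(G)\}\bigr) \quad \text{if } n \text{ is odd}.$$
   Context: Multigraphs are finite and loopless, multiple edges allowed. $\chi'(G)$ is the chromatic index (minimum number of matchings covering $E(G)$) and $\Delta(G)$ the maximum degree. For a multigraph $H$ of odd order $n(H) \ge 3$ with $e(H)$ edges, let $t(H) = 2e(H)/(n(H)-1)$. For $S \subseteq V(G)$, $\langle S\rangle$ denotes the induced subgraph. Let $\Gamma(G) = \max\{ t(\langle S\rangle) : S \subseteq V(G),\ |S| \text{ odd},\ |S|\ge 3\}$. The fractional chromatic index is $\chi_f(G) = \max\{\Delta(G), \Gamma(G)\}$ (and $\chi_f(G)=\Delta(G)$ if $G$ has fewer than 3 vertices), and $\phi(G) = \lceil \chi_f(G) \rceil$. *)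

(* Defs.v *)
From mathcomp Require Import all_boot.
From Stdlib Require Import Reals.
Set Implicit Arguments. Unset Strict Implicit. Unset Printing Implicit Defensive.

(* A finite loopless multigraph is given by a finite vertex type V, a finite
   edge type E and endpoint maps eu ew : E -> V with eu e != ew e for all e.
   Parallel edges = distinct elements of E with the same endpoints. *)

Section Multigraph.
Variables (V E : finType) (eu ew : E -> V).

Definition incident (e : E) (v : V) : bool := (eu e == v) || (ew e == v).

(* degree of v (loopless, so each incident edge counts once) *)
Definition deg (v : V) : nat := #|[set e | incident e v]|.

Definition maxdeg : nat := \max_(v : V) deg v.

Definition e_ind (S : {set V}) : nat := #|[set e | (eu e \in S) && (ew e \in S)]|.

Definition proper_colouring (k : nat) (c : E -> 'I_k) : Prop :=
  forall e f : E, e != f -> c e = c f -> ~~ [exists v, incident e v && incident f v].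

Definition colourable (k : nat) : bool :=
  [exists c : {ffun E -> 'I_k}, [forall e, forall f,
     ((e != f) && (c e == c f)) ==> ~~ [exists v, incident e v && incident f v]]].

Lemma colourableP k : reflect (exists c : E -> 'I_k, proper_colouring c) (colourable k).
Proof.
apply: (iffP existsP) => [[c /forallP Hc]|[c Hc]].
  exists c => e f nef cef; move/forallP: (Hc e) => /(_ f) /implyP; apply.
  by rewrite nef cef eqxx.
exists (finfun c); apply/forallP => e; apply/forallP => f; apply/implyP.
by case/andP => nef; rewrite !ffunE => /eqP; apply: Hc.
Qed.

Lemma colourable_card : exists k, colourable k.
Proof.
exists #|E|; apply/colourableP; exists (@enum_rank E) => e f nef /enum_rank_inj efE.
by rewrite efE eqxx in nef.
Qed.

Definition chromatic_index : nat := ex_minn colourable_card.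

Open Scope R_scope.

Definition t_ind (S : {set V}) : R := 2 * INR (e_ind S) / INR (#|S| - 1)%nat.

(* Gamma(G) = max of t(<S>) over odd S with |S| >= 3 (0 if there is none;
   all values are >= 0 so this does not affect max{Delta, Gamma}) *)
Definition Gamma : R :=
  \big[Rmax/0]_(S : {set V} | odd #|S| && leq 3 #|S|) t_ind S.

Definition chi_f : R := Rmax (INR maxdeg) Gamma.

Definition Rceil (x : R) : Z := (- Int_part (- x))%Z.

Definition phi : Z := Rceil chi_f.

End Multigraph.

Definition log32 (x : R) : R := (ln x / ln (3/2))%R.

(* Main.v *)
(* By density, phi <= k says that every odd vertex set X satisfies
     cut X + sum over X of (k - deg v) >= k,
   a condition ("good") formulated with edge cuts only.  For odd n add an isolated vertex.

   - If an odd set Z minimises the cut up to the slack of the vertices that are moved ("flat"),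
     contracting either side of Z keeps the multigraph good, and colourings of the two
     contractions glue together, since the edges of the cut get distinct colours in both.
   - In a good multigraph without nontrivial flat sets, any odd cut that is too small is
     dominated by a single vertex w on one of its sides.  Vertices with much slack can be joined by
     new edges, so that w is the only vertex of exceptionally small degree.  Counting the edges of
     a Tutte barrier then produces a perfect matching whose removal lowers the palette by one.
   - Put m = min(n/3, phi).  With one colour to spare at each vertex this runs until the palette
     has dropped to m + 1, except on pieces of order at most 2m.  With a second spare colour it runs
     on until the palette is 2m/3, except on pieces of order at most 4m/3: now each step may use
     up the spare colour of one vertex, and at most about m/3 steps remain.
   Hence a factor 3/2 in m costs one extra colour, and two extra colours pay for (3/2)^2. *)

Require Import Defs.
From mathcomp Require Import all_boot.
From mathcomp Require Import zify.
Set Implicit Arguments. Unset Strict Implicit. Unset Printing Implicit Defensive.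

(** * Tutte's theorem *)

Section Tutte.
Variable V : finType.
Implicit Types (e : rel V) (m : V -> V) (S T U : {set V}) (F : {set {set V}}).

Definition perfect e := exists m, involutive m /\ forall x, e x (m x).

(** The members of [F] need not be connected: that they are odd and send edges only to [T] is all
    that the counts below use. *)
Definition barrier e T F :=
  [/\ trivIset F, forall C, C \in F -> odd #|C| /\ [disjoint C & T],
      forall C x y, C \in F -> x \in C -> e x y -> y \in C :|: T
    & #|T| < #|F|].

Definition add_pair e a c : rel V :=
  fun x y => [|| e x y, (x == a) && (y == c) | (x == c) && (y == a)].

(* The alternating path from [d] in [m1 + m2], beginning with an [m1]-edge, either avoids
   [a] and [c], or is cut at the first of them and closed up through [b]. *)
Lemma perfect_exchange e a b c d m1 m2 :
    symmetric e -> irreflexive e -> e a b -> e b c -> b != d ->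
    involutive m1 -> (forall x, m1 x != x) -> m1 a = c ->
    (forall x, x != a -> x != c -> e x (m1 x)) ->
    involutive m2 -> (forall x, m2 x != x) -> m2 b = d ->
    (forall x, x != b -> x != d -> e x (m2 x)) ->
  perfect e.
Proof.
move=> esym eirr eab ebc nbd m1K fp1 m1a e1 m2K fp2 m2b e2.
have m1c : m1 c = a by rewrite -m1a m1K.
have m2d : m2 d = b by rewrite -m2b m2K.
pose y i := iter i (m2 \o m1) d.
have yS i : y i.+1 = m2 (m1 (y i)) by [].
(* Parity along the walk: an equation [y (q + n.+2) = m1 (y q)] can be shortened at both ends, down
   to a fixed point of [m1] or [m2]. *)
have alt0 n q : y (q + n) != m1 (y q).
  elim/ltn_ind: n q => -[|[|n]] IH q; first by rewrite addn0 eq_sym.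
    by rewrite addn1 yS.
  rewrite addnS yS; apply/eqP => E.
  have := IH n (ltnW (leqnn _)) q.+1.
  by rewrite addSnnS yS -E !m2K m1K eqxx.
have alt p q : y p != m1 (y q).
  case: (leqP q p) => [/subnKC<-|/ltnW /subnKC<-]; first exact: alt0.
  by apply/eqP => E; have := alt0 (q - p) p; rewrite E m1K eqxx.
have yinj : injective (m2 \o m1) by apply: inj_comp; apply: inv_inj.
case: (boolP [exists i : 'I_#|V|.+1, (y i == a) || (y i == c)]) => [/existsP [i0 Hi0]|Hno].
- have ex : exists i, (y i == a) || (y i == c) by exists i0.
  case: (ex_minnP ex) => i Hi imin {i0 Hi0 ex}.
  pose a' := y i.
  have ea'b : e a' b.
    by rewrite /a'; case/orP: Hi => /eqP ->; rewrite // esym.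
  have yn j : j < i -> (y j != a) && (y j != c).
    by move=> ji; rewrite -negb_or; apply: contraTN ji => /imin; rewrite -leqNgt.
  (* [a'] is the first of [a], [c] on the walk. The new matching is [m1] on the part [S] before it,
     the pair [a'], [b], and [m2] elsewhere. *)
  pose S := [set x | [exists j : 'I_i, (x == y j) || (x == m1 (y j))]].
  have inS x : reflect (exists2 j, j < i & x = y j \/ x = m1 (y j)) (x \in S).
    rewrite inE; apply: (iffP existsP) => [[j /orP H]|[j ji H]].
      by exists j => //; case: H => /eqP; [left|right].
    by exists (Ordinal ji) => /=; case: H => ->; rewrite eqxx ?orbT.
  have S1 x : x \in S -> m1 x \in S.
    by case/inS => j ji [->|->]; apply/inS; exists j; rewrite ?m1K; auto.
  have a'S : a' \notin S.
    apply/inS => -[j ji [E|E]].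
      by have := yn j ji; rewrite -E /a'; case/orP: Hi => /eqP ->; rewrite eqxx ?andbF.
    by have := alt i j; rewrite -/a' E eqxx.
  have bS : b \notin S.
    apply/inS => -[j ji [E|E]].
      case: j ji E => [_ E|j ji E]; first by rewrite E eqxx in nbd.
      have := alt 0 j; rewrite {1}/y /= -m2b E yS m2K.
      by rewrite eqxx.
    have E0 : y j.+1 = d by rewrite yS -E m2b.
    (* If the walk met [b] before [a'], it would be back at [d], so [a'] would also occur [j.+1]
       steps earlier. *)
    have: (y (i - j.+1) == a) || (y (i - j.+1) == c).
      suff -> : y (i - j.+1) = y i by [].
      by rewrite -[in RHS](subnK ji) {2}/y iterD -/(y j.+1) E0.
    by move/imin; rewrite leqNgt ltn_subrL (leq_ltn_trans _ ji).
  have a'b : a' != b by apply: contraTneq ea'b => ->; rewrite eirr.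
  have S2 x : x \notin S -> x != a' -> x != b -> [/\ m2 x \notin S, m2 x != a' & m2 x != b].
    move=> xS xa xb; split.
    - apply/inS => -[j ji [E|E]].
        case: j ji E => [_ E|j ji E].
          by move: xb; rewrite -(m2K x) E /y /= m2d eqxx.
        by case/negP: xS; apply/inS; exists j; [exact: ltnW|right; rewrite -(m2K x) E yS m2K].
      have xE : x = y j.+1 by rewrite yS -E m2K.
      case: (ltngtP j.+1 i) => [ji1|ji1|ji1]; last by rewrite xE ji1 eqxx in xa.
        by case/negP: xS; apply/inS; exists j.+1; auto.
      by rewrite ltnS leqNgt ji in ji1.
    - apply/eqP => E; have xE : x = m2 (y i) by rewrite -/a' -E m2K.
      case: (posnP i) => i0; first by move: xb; rewrite xE i0 /y /= m2d eqxx.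
      case/negP: xS; apply/inS; exists i.-1; first by rewrite ltn_predL.
      by right; rewrite xE -(prednK i0) yS m2K.
    - apply/eqP => E; have xE : x = d by rewrite -m2b -E m2K.
      case: (posnP i) => i0; first by move: xa; rewrite xE /a' i0 eqxx.
      by case/negP: xS; apply/inS; exists 0; [|left].
  pose m x := if x \in S then m1 x else if x == a' then b else if x == b then a' else m2 x.
  exists m; split=> x; rewrite /m.
    have [xS|xS] := boolP (x \in S); first by rewrite S1 // m1K.
    have [->|xa] := eqVneq x a'; first by rewrite (negPf bS) [b == a']eq_sym (negPf a'b) eqxx.
    have [->|xb] := eqVneq x b; first by rewrite (negPf a'S) eqxx.
    by have [/negPf-> /negPf-> /negPf->] := S2 x xS xa xb; rewrite m2K.
  case: ifPn => xS.
    have c'S : m1 a' \notin S by apply: contra a'S => /S1; rewrite m1K.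
    have [aS cS] : a \notin S /\ c \notin S.
      by move: a'S c'S; rewrite /a'; case/orP: Hi => /eqP ->; rewrite ?m1a ?m1c.
    by apply: e1; apply: contraTneq xS => ->.
  case: ifPn => [/eqP->//|xa].
  case: ifPn => [/eqP->|xb]; first by rewrite esym.
  apply: e2 => //; apply: contraNneq xS => xd.
  case: (posnP i) => i0; first by move: xa; rewrite xd /a' i0 eqxx.
  by apply/inS; exists 0; [|left].
have ord n : exists2 i, i < #|V|.+1 & y n = y i.
  exists (findex (m2 \o m1) d (y n)).
    by rewrite ltnS (leq_trans (ltnW (findex_max (fconnect_iter _ _ _)))) ?max_card.
  by rewrite {2}/y iter_findex // fconnect_iter.
have yn j : (y j != a) && (y j != c).
  rewrite -negb_or; have [i il ->] := ord j.
  by move: Hno; rewrite negb_exists => /forallP /(_ (Ordinal il)).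
(* Here the walk closes up to a cycle through [b] and [d] that avoids [a] and [c]: take [m1] on it
   and [m2] off it. *)
pose S := [set x | fconnect (m2 \o m1) d x || fconnect (m2 \o m1) d (m1 x)].
have inS x : reflect (exists j, x = y j \/ x = m1 (y j)) (x \in S).
  rewrite inE; apply: (iffP orP) => [[H|H]|[j [->|->]]].
  - by exists (findex (m2 \o m1) d x); left; rewrite /y iter_findex.
  - by exists (findex (m2 \o m1) d (m1 x)); right; rewrite /y iter_findex // m1K.
  - by left; apply: fconnect_iter.
  - by right; rewrite m1K; apply: fconnect_iter.
have S1 x : x \in S -> m1 x \in S.
  by case/inS => j [->|->]; apply/inS; exists j; rewrite ?m1K; auto.
have S2 x : x \in S -> m2 x \in S.
  case/inS => j [->|->]; apply/inS; last by exists j.+1; left.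
  case: j => [|j]; last by exists j; right; rewrite yS m2K.
  have [n En] : exists n, y n.+1 = d.
    exists (fingraph.order (m2 \o m1) d).-1; rewrite prednK ?order_gt0 //.
    by rewrite /y iter_order.
  by exists n; right; rewrite -[y 0]En yS m2K.
pose m x := if x \in S then m1 x else m2 x.
exists m; split=> x; rewrite /m.
  have [xS|xS] := boolP (x \in S); first by rewrite S1 // m1K.
  by rewrite ifN ?m2K //; apply: contra xS => /S2; rewrite m2K.
case: ifPn => xS.
  apply: e1; apply: contraTneq xS => ->; apply/inS => -[j [E|E]].
  - by have := yn j; rewrite -E eqxx.
  - by have := yn j; rewrite -(m1K (y j)) -E m1a eqxx andbF.
  - by have := yn j; rewrite -E eqxx andbF.
  - by have := yn j; rewrite -(m1K (y j)) -E m1c eqxx.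
have dS : d \in S by apply/inS; exists 0; left.
by apply: e2; apply: contraNneq xS => -> //; rewrite -m2d S2.
Qed.

Definition perfect_on e S := exists m, forall x, x \in S -> [/\ m x \in S, m (m x) = x & e x (m x)].

Lemma perfect_on_pair e S x y : symmetric e -> x \in S -> y \in S -> x != y -> e x y ->
  perfect_on e (S :\: [set x; y]) -> perfect_on e S.
Proof.
move=> esym xS yS nxy exy [m Hm].
exists (fun z => if z == x then y else if z == y then x else m z) => z zS.
have [->|zx] := eqVneq z x; first by rewrite eq_sym (negPf nxy) eqxx.
have [->|zy] := eqVneq z y; first by rewrite eqxx esym.
have [] := Hm z; first by rewrite !inE (negPf zx) (negPf zy).
by rewrite !inE negb_or => /andP[/andP[/negPf-> /negPf->] ->].
Qed.

Section Cliques.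
Variables (e : rel V) (U : {set V}) (K : finType) (kappa : V -> K).
Hypothesis esym : symmetric e.
Hypothesis univ : forall u y, u \in U -> y != u -> e u y.
Hypothesis clique : forall x y, x \notin U -> y \notin U -> x != y -> kappa x = kappa y -> e x y.

Definition kclass S k := [set x in S :\: U | kappa x == k].
Definition oddclasses S := [set k | odd #|kclass S k|].

(** Pairs are removed one at a time: two vertices of one class; once all classes are singletons,
    such a vertex with one of [U]; finally two vertices of [U]. Each removal keeps the
    inequality. *)
Lemma perfect_on_cliques S : ~~ odd #|S| -> #|oddclasses S| <= #|S :&: U| -> perfect_on e S.
Proof.
have [n] := ubnP #|S|; elim: n S => // n IH S ltn oS le.
have smaller x y : x \in S -> y \in S -> x != y ->
    #|S :\: [set x; y]| = #|S| - 2 /\ 2 <= #|S|.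
  move=> xS yS nxy; have sub : [set x; y] \subset S by rewrite subUset !sub1set xS.
  by rewrite cardsD (setIidPr sub) -[2](_ : #|[set x; y]| = 2) ?subset_leq_card // cards2 nxy.
have step x y : x \in S -> y \in S -> x != y -> e x y ->
    #|oddclasses (S :\: [set x; y])| <= #|(S :\: [set x; y]) :&: U| -> perfect_on e S.
  move=> xS yS nxy exy le'; apply: (perfect_on_pair esym xS yS nxy exy).
  have [E ge2] := smaller x y xS yS nxy.
  apply: IH le'; first by rewrite E; move: ltn ge2; clear; lia.
  by rewrite E oddB // addbF.
case: (boolP [exists x in S :\: U, exists y in S :\: U, (x != y) && (kappa x == kappa y)]).
  case/exists_inP => x xSU /exists_inP[y ySU /andP[nxy /eqP kxy]].
  move: (xSU) (ySU); rewrite !inE => /andP[xU xS] /andP[yU yS].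
  apply: (step x y) => //; first exact: clique.
  have -> : (S :\: [set x; y]) :&: U = S :&: U.
    apply/setP => z; rewrite !inE; case: (z =P x) => [->|_]; first by rewrite (negPf xU) !andbF.
    by case: (z =P y) => [->|_]; rewrite ?(negPf yU) ?andbF.
  apply: leq_trans le; apply: subset_leq_card; apply/subsetP => k; rewrite !inE.
  have -> : kclass (S :\: [set x; y]) k = kclass S k :\: [set x; y].
    by apply/setP => z; rewrite !inE; case: (_ || _); rewrite ?andbF.
  have [kx|nkx] := eqVneq (kappa x) k.
    have sub : [set x; y] \subset kclass S k by rewrite subUset !sub1set !inE xU yU xS yS -kxy kx !eqxx.
    rewrite cardsD (setIidPr sub) oddB ?subset_leq_card // cards2 nxy addbF //.
  suff -> : kclass S k :\: [set x; y] = kclass S k by [].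
  apply/setP => z; rewrite !inE.
  case: (z =P x) => [->|_] /=; first by rewrite (negPf nkx) andbF.
  by case: (z =P y) => [->|_] //=; rewrite -kxy (negPf nkx) andbF.
rewrite negb_exists => /forallP noeq.
have {}noeq x y : x \in S -> x \notin U -> y \in S -> y \notin U -> kappa x = kappa y -> x = y.
  move=> xS xU yS yU kxy; apply: contraTeq isT => nxy.
  have := noeq x; rewrite !inE xS xU negb_exists => /forallP /(_ y).
  by rewrite !inE yS yU nxy kxy eqxx.
have [SU0|[x xSU]] := set_0Vmem (S :\: U); last first.
  move: (xSU); rewrite !inE => /andP[xU xS].
  have kx1 : kclass S (kappa x) = [set x].
    apply/setP => z; rewrite !inE; apply/idP/eqP => [/andP[/andP[zU zS] /eqP kz]|->].
      exact: noeq.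
    by rewrite xU xS eqxx.
  have kxo : kappa x \in oddclasses S by rewrite inE kx1 cards1.
  have: 0 < #|S :&: U| by apply: leq_trans le; rewrite card_gt0; apply/set0Pn; exists (kappa x).
  rewrite card_gt0 => /set0Pn[u]; rewrite inE => /andP[uS uU].
  have nxu : x != u by apply: contraNneq xU => ->.
  apply: (step x u) => //; first by rewrite esym univ.
  have -> : (S :\: [set x; u]) :&: U = (S :&: U) :\ u.
    apply/setP => z; rewrite !inE; case: (z =P x) => [->|_]; first by rewrite (negPf xU) !andbF.
    by case: (z =P u); rewrite ?andbT.
  have uSU : u \in S :&: U by rewrite inE uS.
  rewrite -ltnS; move: le; rewrite (cardsD1 u) uSU add1n; apply: leq_trans.
  rewrite (cardsD1 (kappa x) (oddclasses S)) kxo add1n ltnS.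
  apply: subset_leq_card; apply/subsetP => k; rewrite !inE => ok.
  have [kx|nkx] := eqVneq k (kappa x).
    move: ok; rewrite kx; suff -> : kclass (S :\: [set x; u]) (kappa x) = set0 by rewrite cards0.
    apply/setP => z; rewrite !inE; apply/negP => /andP[/andP[zU /andP[zxu zS]] /eqP kz].
    by move: zxu; rewrite (noeq z x) // eqxx.
  suff <- : kclass (S :\: [set x; u]) k = kclass S k by [].
  apply/setP => z; rewrite !inE.
  case: (z =P x) => [->|_] /=; first by rewrite eq_sym (negPf nkx) !andbF.
  by case: (z =P u) => [->|_] //=; rewrite uU.
have SU : S \subset U by rewrite -setD_eq0 SU0.
have [S0|[x xS]] := set_0Vmem S; first by exists id => x; rewrite S0 inE.
have: 0 < #|S :\ x|.
  by rewrite lt0n; apply: contraNneq oS => E; rewrite (cardsD1 x) xS E.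
rewrite card_gt0 => /set0Pn[y]; rewrite !inE => /andP[nyx yS].
apply: (step x y) => //; first by rewrite eq_sym.
  by rewrite univ // (subsetP SU).
suff -> : oddclasses (S :\: [set x; y]) = set0 by rewrite cards0.
apply/setP => k; rewrite !inE; apply/negbTE.
suff -> : kclass (S :\: [set x; y]) k = set0 by rewrite cards0.
apply/setP => z; rewrite !inE; apply/negP => /andP[/andP[/negP zU /andP[_ zS]] _].
by case: zU; apply: (subsetP SU).
Qed.

End Cliques.

(** Lovasz's argument, by induction on the number of non-edges. A barrier survives the loss of
    edges, so adding any pair may be assumed to create a perfect matching. An induced path [a b c]
    with [b] not universal then allows an exchange; without such paths the non-universal vertices
    form disjoint cliques. *)
Theorem tutte e : symmetric e -> irreflexive e -> ~~ odd #|V| ->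
  perfect e \/ exists T F, barrier e T F.
Proof.
move=> esym eirr oV.
have [n] := ubnP #|[set p : V * V | ~~ e p.1 p.2]|.
elim: n e esym eirr => // n IH e esym eirr ltn.
have mono a c T F : barrier (add_pair e a c) T F -> barrier e T F.
  case=> h1 h2 h3 h4; split=> // C x y CF xC exy; apply: h3 CF xC _.
  by rewrite /add_pair exy.
have aug a c : a != c -> ~~ e a c -> perfect e \/
    (exists m, [/\ involutive m, forall x, m x != x, m a = c
                 & forall x, x != a -> x != c -> e x (m x)]) \/ exists T F, barrier e T F.
  move=> nac neac; have [|||[m [mK em]]|[T [F B]]] := IH (add_pair e a c).
  - by move=> x y; rewrite /add_pair esym; case: (x == a); case: (x == c); case: (y == a); case: (y == c); rewrite ?orbT.
  - by move=> x; rewrite /add_pair eirr /=; case: (x =P a) => [->|]; rewrite ?(negPf nac) ?andbF.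
  - rewrite -ltnS; apply: leq_trans ltn; rewrite ltnS; apply: proper_card; apply/properP; split.
      by apply/subsetP => p; rewrite !inE negb_or => /andP[].
    by exists (a, c); rewrite !inE //= /add_pair !eqxx orbT.
  - case: (boolP [forall x, e x (m x)]) => [/forallP H|]; first by left; exists m.
    rewrite negb_forall => /existsP[x0 nx0]; right; left; exists m.
    have mac : m a = c.
      have := em x0; rewrite /add_pair (negPf nx0) /= => /orP[] /andP[/eqP<- /eqP<-] //.
    split=> // [x|x xa xc].
      apply/eqP => E; have := em x; rewrite E /add_pair eirr /= orbC andbC orbb.
      by case/andP=> /eqP xa /eqP xc; move: nac; rewrite -xa -xc eqxx.
    by have := em x; rewrite /add_pair (negPf xa) (negPf xc) !orbF.
  - by right; right; exists T, F; apply: mono B.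
have [U inU] : exists U : {set V}, forall x, (x \in U) = [forall y, (y != x) ==> e x y].
  by exists [set x | [forall y, (y != x) ==> e x y]] => x; rewrite inE.
have univ u y : u \in U -> y != u -> e u y.
  by rewrite inU => /forallP /(_ y) /implyP.
pose adj x y := (x == y) || e x y.
case: (boolP [exists a, exists b, exists c,
    [&& b \notin U, a != c, e a b, e b c & ~~ e a c]]) => [|].
  case/existsP => a /existsP[b /existsP[c /and5P[bU nac eab ebc neac]]].
  move: bU; rewrite inU negb_forall => /existsP[d]; rewrite negb_imply => /andP[ndb nebd].
  have [|[[m1 [m1K f1 m1a e1]]|]] := aug a c nac neac; [by left| |by right].
  rewrite eq_sym in ndb.
  have [|[[m2 [m2K f2 m2b e2]]|]] := aug b d ndb nebd; [by left| |by right].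
  by left; apply: (perfect_exchange esym eirr eab ebc ndb m1K f1 m1a e1 m2K f2 m2b e2).
move=> noP.
have trans a b c : b \notin U -> a != c -> e a b -> e b c -> e a c.
  move=> bU nac eab ebc; apply: contraNT noP => neac.
  by apply/existsP; exists a; apply/existsP; exists b; apply/existsP; exists c; apply/and5P.
(* Adjacency off [U] is now an equivalence. Naming a class by its own vertex set lets the odd
   classes serve directly as the barrier's [F]. *)
pose kappa x := [set y in ~: U | adj x y].
have kappaP x y : x \notin U -> y \notin U -> reflect (kappa x = kappa y) (adj x y).
  move=> xU yU; apply: (iffP idP) => [axy|E]; last first.
    have: y \in kappa y by rewrite !inE yU /adj eqxx.
    by rewrite -E !inE => /andP[].
  apply/setP => z; rewrite !inE; congr andb; rewrite /adj; move: axy; rewrite /adj.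
  have [->//|nxy /= exy] := eqVneq x y.
  have [<-|nxz] /= := eqVneq x z; first by rewrite esym exy orbT.
  have [<-|nyz] /= := eqVneq y z; first by rewrite exy.
  by apply/idP/idP => [exz|eyz]; [apply: (trans y x z) => //; rewrite esym|apply: (trans x y z)].
have [le|gt] := leqP #|oddclasses U kappa [set: V]| #|U|.
  left; have clq x y : x \notin U -> y \notin U -> x != y -> kappa x = kappa y -> e x y.
    by move=> xU yU nxy /(kappaP x y xU yU); rewrite /adj (negPf nxy).
  have [||m Hm] := perfect_on_cliques esym univ clq (S := [set: V]).
  - by rewrite cardsT.
  - by rewrite setTI.
  by exists m; split=> x; have [] := Hm x.
right.
have kcE k : k \in oddclasses U kappa [set: V] -> kclass U kappa [set: V] k = k.
  rewrite inE => ok; have: 0 < #|kclass U kappa [set: V] k| by case: #|_| ok.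
  rewrite card_gt0 => /set0Pn[x]; rewrite !inE => /andP[/andP[xU _] /eqP <-].
  apply/setP => y; rewrite !inE andbT; case: (boolP (y \in U)) => //= yU.
  by apply/eqP/idP => [E|/kappaP E]; [apply/kappaP|rewrite E].
exists U, (oddclasses U kappa [set: V]); split=> //.
- apply/trivIsetP => A B AF BF nAB; rewrite -setI_eq0; apply/eqP/setP => x; rewrite !inE.
  apply/negP => /andP[]; rewrite -{1}(kcE A AF) -{1}(kcE B BF) !inE => /andP[_ /eqP xA] /andP[_ /eqP xB].
  by rewrite -xA -xB eqxx in nAB.
- move=> C CF; split; first by rewrite -(kcE C CF); move: CF; rewrite inE.
  rewrite -setI_eq0; apply/eqP/setP => x; rewrite -(kcE C CF) !inE.
  by case: (x \in U); rewrite ?andbF.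
- move=> C x y CF; rewrite -{1}(kcE C CF) !inE => /andP[/andP[xU _] /eqP xC] exy.
  case: (boolP (y \in U)) => yU; first by rewrite orbT.
  by rewrite orbF -xC !inE yU /adj exy orbT.
Qed.

(* Parity: the vertices outside the barrier and its members form one more closed odd set. *)
Lemma tutte_barrier e : symmetric e -> irreflexive e -> ~~ odd #|V| ->
  perfect e \/ exists T F, barrier e T F /\ #|T|.+2 <= #|F|.
Proof.
move=> esym eirr oV; have [|[T [F [tF oF cF]]]] := tutte esym eirr oV; first by left.
rewrite leq_eqVlt => /orP[/eqP E|]; last by right; exists T, F; split=> //; split=> //; apply: ltnW.
right; pose R := ~: (T :|: cover F).
have dTF : [disjoint T & cover F].
  rewrite -setI_eq0; apply/eqP/setP => x; rewrite !inE; apply/negP => /andP[xT /bigcupP[C CF xC]].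
  by have [_ /disjointFr /(_ xC)] := oF C CF; rewrite xT.
have oc : odd #|cover F| = odd #|F|.
  have -> : #|cover F| = \sum_(C in F) #|C| by rewrite (eqP tF).
  rewrite -sum1_card !(big_morph odd oddD (erefl _)).
  by apply: eq_bigr => C CF; have [->] := oF C CF.
have oR : odd #|R|.
  have := cardsC (T :|: cover F); rewrite -/R => /(congr1 odd).
  rewrite oddD (negPf oV) cardsU (_ : T :&: cover F = set0) ?cards0 ?subn0; last first.
    by apply/eqP; rewrite setI_eq0.
  by rewrite oddD oc -E /=; do 2!case: odd.
have RF : R \notin F.
  apply/negP => RF; have: 0 < #|R| by case: #|R| oR.
  rewrite card_gt0 => /set0Pn[x xR]; have: x \in cover F by apply/bigcupP; exists R.
  by move: xR; rewrite !inE negb_or => /andP[_ /negP].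
have le : #|T|.+2 <= #|R |: F| by rewrite cardsU1 RF -E.
exists T, (R |: F); split=> //; split; last exact: ltnW.
- rewrite /trivIset; apply/trivIsetP => A B; rewrite !inE.
  have dR C : C \in F -> [disjoint C & R].
    move=> CF; rewrite -setI_eq0; apply/eqP/setP => x; rewrite !inE; apply/negP => /andP[xC].
    by rewrite negb_or => /andP[_ /bigcupP[]]; exists C.
  move=> /orP[/eqP->|AF] /orP[/eqP->|BF] nAB; first by rewrite eqxx in nAB.
  + by rewrite disjoint_sym dR.
  + exact: dR.
  + by apply: (trivIsetP tF).
- move=> C; rewrite !inE => /orP[/eqP->|CF]; last exact: oF.
  split=> //; rewrite -setI_eq0; apply/eqP/setP => x; rewrite !inE.
  by case: (x \in T); rewrite ?andbF.
- move=> C x y; rewrite !inE => /orP[/eqP->|CF] xC exy; last by have := cF C x y CF xC exy; rewrite !inE.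
  rewrite !inE; case: (boolP (y \in T)) => yT /=; first by rewrite ?orbT.
  rewrite orbF; apply: contraTN xC => /bigcupP[C' CF yC'].
  rewrite esym in exy; have := cF C' y x CF yC' exy; rewrite !inE => /orP[xC|->//].
  by rewrite negbK; apply/orP; right; apply/bigcupP; exists C'.
Qed.

End Tutte.

(** * Cuts, contractions and colourings *)

Section Graph.
Variables (V E : finType).
Implicit Types (g : E -> V * V) (X Y Z R : {set V}) (M : {set E}).

(* Loops lie in no cut, so a loop stands for a deleted edge. *)
Definition bd g X := [set e | ((g e).1 \in X) != ((g e).2 \in X)].
Definition cut g X := #|bd g X|.
Definition vdeg g v := cut g [set v].
Definition slack g k X := \sum_(v in X) (k - vdeg g v).
Definition dist g k X Y := \sum_(v | (v \in X) != (v \in Y)) (k - vdeg g v).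

(* Given the degree condition, the second one says [2 e(X) <= k (#|X| - 1)]: the degrees
   over [X] add up to [cut g X + 2 e(X)]. *)
Definition good g k :=
  (forall v, vdeg g v <= k) /\ (forall X, odd #|X| -> k <= cut g X + slack g k X).

(** Only edges in some [bd] are constrained, so loops, that is deleted edges, are free. *)
Definition colouring g k (c : E -> nat) := forall v e, e \in bd g [set v] ->
  c e < k /\ forall f, f \in bd g [set v] -> c e = c f -> e = f.
Definition kcol g k := exists c, colouring g k c.

Lemma bdC g X : bd g (~: X) = bd g X.
Proof. by apply/setP => e; rewrite !inE; case: (_ \in X); case: (_ \in X). Qed.

Lemma cutC g X : cut g (~: X) = cut g X.
Proof. by rewrite /cut bdC. Qed.

Lemma bd_cover g X e : e \in bd g X -> exists2 v, v \in X & e \in bd g [set v].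
Proof.
rewrite inE; case: (boolP (_ \in X)) => [h1|h1]; case: (boolP (_ \in X)) => //= h2 _.
  exists (g e).1 => //; rewrite !inE eqxx.
  by suff -> : ((g e).2 == (g e).1) = false by []; apply: contraNF h2 => /eqP->.
exists (g e).2 => //; rewrite !inE eqxx.
by suff -> : ((g e).1 == (g e).2) = false by []; apply: contraNF h1 => /eqP->.
Qed.

Lemma cardI_bd g X M : #|M :&: bd g X| <= \sum_(v in X) #|M :&: bd g [set v]|.
Proof.
apply: leq_trans (_ : #|\bigcup_(v in X) (M :&: bd g [set v])| <= _).
  apply: subset_leq_card; apply/subsetP => e; rewrite inE => /andP[eM /bd_cover[v vX ev]].
  by apply/bigcupP; exists v; rewrite // inE eM.
elim/big_rec2: _ => [|v n U _ IH]; first by rewrite cards0.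
by apply: leq_trans (leq_card_setU _ _) _; rewrite leq_add2l.
Qed.

Lemma odd_cut g X : odd (cut g X) = odd (\sum_(v in X) vdeg g v).
Proof.
have oddC (Y : {set V}) : odd (cut g Y) = \big[addb/false]_e (((g e).1 \in Y) (+) ((g e).2 \in Y)).
  rewrite /cut -sum1dep_card big_mkcond (big_morph odd oddD (erefl _)).
  by apply: eq_bigr => e _; case: (_ \in Y); case: (_ \in Y).
rewrite (big_morph odd oddD (erefl _)) oddC.
under [RHS]eq_bigr => v _ do rewrite oddC.
rewrite exchange_big /=; apply: eq_bigr => e _.
rewrite big_split /=.
have mem u : \big[addb/false]_(v in X) (u \in [set v]) = (u \in X).
  case: (boolP (u \in X)) => uX.
    rewrite (bigD1 u) //= inE eqxx big1 // => v /andP[_ nvu].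
    by rewrite inE eq_sym (negPf nvu).
  by rewrite big1 // => v vX; rewrite inE; apply: contraNF uX => /eqP->.
by rewrite !mem.
Qed.

Lemma slackE g k X : (forall v, vdeg g v <= k) ->
  slack g k X + \sum_(v in X) vdeg g v = k * #|X|.
Proof.
move=> le; rewrite -big_split /= mulnC -sum_nat_const.
by apply: eq_bigr => v _; rewrite subnK.
Qed.

(** So an odd set that is not tight in a good multigraph has an excess of at least 2. *)
Lemma odd_excess g k X : (forall v, vdeg g v <= k) -> odd #|X| ->
  odd (cut g X + slack g k X) = odd k.
Proof.
move=> le oX; have /(congr1 odd) := slackE X le.
by rewrite oddM oX andbT oddD oddD odd_cut addbC.
Qed.

Lemma slack1 g k v : slack g k [set v] = k - vdeg g v.
Proof. by rewrite /slack big_set1. Qed.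

Lemma slackC g k X : slack g k X + slack g k (~: X) = slack g k [set: V].
Proof.
rewrite /slack [RHS](bigID (mem X)) /=; congr addn; apply: eq_bigl => v; rewrite !inE //.
Qed.

Lemma slackU g k X Y : [disjoint X & Y] -> slack g k (X :|: Y) = slack g k X + slack g k Y.
Proof. by move=> dXY; rewrite -bigU //; apply: eq_bigl => v; rewrite !inE. Qed.

Lemma slackS g k X Y : X \subset Y -> slack g k X <= slack g k Y.
Proof.
move=> sXY; rewrite -[Y in _ <= slack _ _ Y](setID Y X) (setIidPr sXY) slackU ?leq_addr //.
by rewrite -setI_eq0 setIDA setDIl setDv set0I.
Qed.

Lemma slackD1 g k X v : v \in X -> slack g k X = k - vdeg g v + slack g k (X :\ v).
Proof. exact: big_setD1. Qed.

Lemma distCC g k X Y : dist g k (~: X) (~: Y) = dist g k X Y.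
Proof. by apply: eq_bigl => v; rewrite !inE; case: (_ \in X); case: (_ \in Y). Qed.

Lemma dist_tri g k X Y Z : dist g k X Z <= dist g k X Y + dist g k Y Z.
Proof.
rewrite /dist !(big_mkcond (fun v => (_ \in _) != _)) -big_split /=.
apply: leq_sum => v _; case: (v \in X); case: (v \in Y); case: (v \in Z) => //=; lia.
Qed.

Lemma dist_sub g k X Y : X \subset Y -> dist g k X Y = slack g k (Y :\: X).
Proof.
move=> /subsetP sXY; apply: eq_bigl => v; rewrite !inE; have := sXY v.
by case: (v \in X) => [->|_] //=; case: (v \in Y).
Qed.

Lemma slack_dist g k X Y : slack g k X <= slack g k Y + dist g k X Y.
Proof.
rewrite /slack /dist [leqLHS]big_mkcond [X in X + _]big_mkcond [X in _ + X]big_mkcond -big_split /=.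
by apply: leq_sum => v _; case: (v \in X); case: (v \in Y) => //=; lia.
Qed.

Lemma dist1 g k v Z : v \in Z -> dist g k [set v] Z = slack g k (Z :\ v).
Proof. by move=> vZ; rewrite dist_sub ?sub1set. Qed.

Lemma dist1_notin g k v Z : v \notin Z -> k - vdeg g v <= dist g k [set v] Z.
Proof. by move=> vZ; rewrite /dist (bigD1 v) ?leq_addr //= !inE eqxx (negPf vZ). Qed.

Lemma good_leq g k k' : k <= k' -> good g k -> good g k'.
Proof.
move=> kk' [dk gk]; split=> [v|X oX]; first exact: leq_trans (dk v) kk'.
have -> : slack g k' X = slack g k X + (k' - k) * #|X|.
  by rewrite mulnC -sum_nat_const -big_split; apply: eq_bigr => v _ /=; have := dk v; lia.
have := gk X oX; have : 0 < #|X| by case: #|X| oX.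
nia.
Qed.

End Graph.

(** * Contracting one side of an odd cut *)

Section Division.
Variables (V E : finType) (g : E -> V * V) (k : nat) (Z : {set V}).

Definition flat := [forall R : {set V}, odd #|R| ==> (cut g Z <= cut g R + dist g k R Z)].

Lemma flatP : reflect (forall R : {set V}, odd #|R| -> cut g Z <= cut g R + dist g k R Z) flat.
Proof. by apply: (iffP forallP) => H R; have /implyP := H R. Qed.

(* All vertices outside [Z] are identified to [None]. *)
Definition contract : E -> option {v | v \in Z} * option {v | v \in Z} :=
  fun e => (insub (g e).1, insub (g e).2).

Lemma bd_contract X : bd contract X = bd g (insub @^-1: X).
Proof. by apply/setP => e; rewrite !inE. Qed.

Lemma insub_Some (u : {v | v \in Z}) : insub @^-1: [set Some u] = [set val u] :> {set V}.
Proof.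
apply/setP => x; rewrite !inE; apply/eqP/eqP => [|->]; last exact: valK.
by case: insubP => //= w _ <- [->].
Qed.

Lemma insub_None : insub @^-1: [set None : option {v | v \in Z}] = ~: Z.
Proof. by apply/setP => x; rewrite !inE; case: insubP => [w ->|/negPf->]. Qed.

Lemma bd_contract_Some u : bd contract [set Some u] = bd g [set val u].
Proof. by rewrite bd_contract insub_Some. Qed.

Lemma bd_contract_None : bd contract [set None] = bd g Z.
Proof. by rewrite bd_contract insub_None bdC. Qed.

Lemma sum_option (F : option {v | v \in Z} -> nat) (X : {set option {v | v \in Z}}) :
  \sum_(x in X) F x = (None \in X) * F None + \sum_(v in Z | insub v \in X) F (insub v).
Proof.
rewrite (bigID (pred1 None)) /=; congr addn.
  case: (boolP (None \in X)) => NX; last first.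
    by rewrite big1 // => x /andP[xX /eqP xN]; rewrite -xN xX in NX.
  by rewrite mul1n (big_pred1 None) // => x /=; case: (x =P None) => [->|_]; rewrite ?NX ?andbF.
rewrite (reindex_omap insub (omap val)) /=; last first.
  by case=> [u|]; rewrite ?andbF //= => _; rewrite valK.
apply: eq_bigl => v; case: insubP => [u vZ uv|/negPf vZ] /=; last by rewrite vZ !andbF.
by rewrite vZ -[sval u]/(val u) uv eqxx !andbT.
Qed.

Lemma card_preim_contract (X : {set option {v | v \in Z}}) :
  #|X| = (None \in X) + #|(insub @^-1: X) :&: Z|.
Proof.
rewrite -sum1_card sum_option muln1 sum1dep_card; congr addn.
by apply: eq_card => v; rewrite !inE andbC.
Qed.

Hypothesis oZ : odd #|Z|.
Hypothesis oV : ~~ odd #|V|.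

(** A set avoiding [None] is an odd subset of [Z]. For a set containing [None], the condition is
    exactly flatness of [Z] tested on the odd set [Z :\: Y]. *)
Lemma good_contract : good g k -> cut g Z <= k -> flat -> good contract k.
Proof.
move=> [dk gk] lek /flatP fl; split=> [[u|]|X oX]; rewrite /vdeg /cut.
- by rewrite bd_contract_Some; apply: dk.
- by rewrite bd_contract_None.
pose Y := insub @^-1: X :&: Z : {set V}.
have YZ : Y \subset Z by apply: subsetIr.
have slY : slack contract k X = (None \in X) * (k - cut g Z) + slack g k Y.
  rewrite /slack sum_option /vdeg /cut bd_contract_None; congr addn.
  rewrite (eq_bigl (mem Y)); last by move=> v; rewrite !inE andbC.
  apply: eq_bigr => v; rewrite !inE => /andP[_ vZ].
  by rewrite (insubT (fun v => v \in Z) vZ) bd_contract_Some.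
have cX := card_preim_contract X; rewrite -/Y in cX.
rewrite slY bd_contract -/(cut g _); case: (boolP (None \in X)) cX => NX cX /=.
  have -> : cut g (insub @^-1: X) = cut g (Z :\: Y).
    rewrite -cutC; congr cut; apply/setP => v; rewrite !inE.
    by case: insubP => [u -> _|/negPf->]; rewrite ?andbT ?NX.
  have oR : odd #|Z :\: Y|.
    by rewrite cardsD (setIidPr YZ) oddB ?subset_leq_card // oZ; move: oX; rewrite cX oddD.
  have := fl _ oR; rewrite dist_sub ?subsetDl // setDDr setDv set0U (setIidPr YZ).
  by lia.
have -> : insub @^-1: X = Y.
  apply/setP => v; rewrite !inE; case: insubP => [u -> _|_]; rewrite ?andbT //.
  by rewrite (negPf NX).
by rewrite mul0n add0n; apply: gk; rewrite -[#|Y|]add0n -cX.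
Qed.

End Division.

(** * Gluing colourings of the two contractions *)

Section Merge.
Variables (V E : finType).
Implicit Types (g : E -> V * V) (Z R : {set V}).

Lemma flatC g k Z : ~~ odd #|V| -> flat g k Z -> flat g k (~: Z).
Proof.
move=> oV /flatP fl; apply/flatP => R oR; rewrite cutC -(cutC g R) -distCC setCK; apply: fl.
have := cardsC R => /(congr1 odd); rewrite oddD oR (negPf oV) /=.
by case: odd.
Qed.

(* A permutation of the colours makes the two colourings agree on the cut. *)
Lemma kcol_merge g k Z : kcol (contract g Z) k -> kcol (contract g (~: Z)) k -> kcol g k.
Proof.
move=> [c1 H1] [c2 H2].
have c1lt e : e \in bd g Z -> c1 e < k by rewrite -bd_contract_None => /H1[].
have c1inj e f : e \in bd g Z -> f \in bd g Z -> c1 e = c1 f -> e = f.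
  by rewrite -bd_contract_None => /H1[_ H] /H.
have align (s : seq E) : uniq s -> {subset s <= bd g Z} ->
    exists c, colouring (contract g (~: Z)) k c /\ {in s, c =1 c1}.
  elim: s => [|e s IH]; first by exists c2.
  rewrite cons_uniq => /andP[es us] sub.
  have [|c [Hc Es]] := IH us; first by move=> f fs; apply: sub; rewrite inE fs orbT.
  have eZ : e \in bd g Z by apply: sub; rewrite mem_head.
  have eN : e \in bd (contract g (~: Z)) [set None] by rewrite bd_contract_None bdC.
  (* Swapping these two colours leaves the edges of [s] alone: they meet [e] at [None] in both
     contractions, so they have neither colour. *)
  pose sw n := if n == c e then c1 e else if n == c1 e then c e else n.
  have swinj : injective sw.
    move=> x y; rewrite /sw.
    case: (x =P c e) => [->|xc]; case: (y =P c e) => [->|yc] //.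
    - by case: (y =P c1 e) => [->|] // => h1 h2; case: h1.
    - by case: (x =P c1 e) => [->|] // => h1 h2; case: h1.
    - by case: (x =P c1 e) => [->|_]; case: (y =P c1 e) => [->|_] // xy; case: yc.
  exists (sw \o c); split.
    move=> v f fv; have [lt inj] := Hc v f fv; split; last first.
      by move=> f' f'v /swinj; apply: inj.
    rewrite /= /sw; case: ifP => _; first exact: c1lt.
    by case: ifP => _ //; have [] := Hc _ _ eN.
  move=> f; rewrite inE => /orP[/eqP->|fs] /=; first by rewrite /sw eqxx.
  have fZ : f \in bd g Z by apply: sub; rewrite inE fs orbT.
  have nfe : f != e by apply: contraNneq es => <-.
  rewrite /sw; case: eqP => [Ef|_].
    have [_ inj] := Hc _ _ eN; case/eqP: nfe; symmetry; apply: inj => //.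
    by rewrite bd_contract_None bdC.
  rewrite (Es f fs); case: eqP => // Ef.
  by case/eqP: nfe; apply: c1inj.
have [||c [Hc Ec]] := align (enum (bd g Z)); first exact: enum_uniq.
  by move=> e; rewrite mem_enum.
(* Edges of the cut have the same colour on both sides, so either colouring may be read there. *)
pose meets e := ((g e).1 \in Z) || ((g e).2 \in Z).
exists (fun e => if meets e then c1 e else c e) => v.
case: (boolP (v \in Z)) => vZ.
  have mt f : f \in bd g [set v] -> meets f.
    rewrite !inE /meets; case: ((g f).1 =P v) => [->|_]; first by rewrite vZ.
    by case: ((g f).2 =P v) => [->|] //; rewrite vZ orbT.
  move=> e ev; rewrite (mt e ev); have [] := H1 (Some (Sub v vZ)) e.
    by rewrite bd_contract_Some.
  move=> lt inj; split=> // f fv; rewrite (mt f fv); apply: inj.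
  by rewrite bd_contract_Some.
have cE f : f \in bd g [set v] -> (if meets f then c1 f else c f) = c f.
  move=> fv; case: ifP => // mf; rewrite Ec // mem_enum inE.
  move: fv mf; rewrite !inE /meets.
  case: ((g f).1 =P v) => [->|_]; first by rewrite (negPf vZ) /= => _ ->.
  by case: ((g f).2 =P v) => [->|] //; rewrite (negPf vZ) orbF => _ ->.
move=> e ev; rewrite (cE e ev).
have vZ' : v \in ~: Z by rewrite inE.
have [] := Hc (Some (Sub v vZ')) e; first by rewrite bd_contract_Some.
by move=> lt inj; split=> // f fv; rewrite (cE f fv); apply: inj; rewrite bd_contract_Some.
Qed.

End Merge.

(** * Irreducible multigraphs *)

Lemma sum_eq_mem (V : finType) (X : {set V}) u : \sum_(v in X) (v == u) = (u \in X).
Proof.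
rewrite -big_mkcondr /= sum1dep_card; case: (boolP (u \in X)) => uX.
  by rewrite (@eq_card1 _ u) // => v; rewrite !inE; case: (v =P u) => [->|]; rewrite ?uX ?andbF.
by rewrite eq_card0 // => v; rewrite !inE; case: (v =P u) => [->|]; rewrite ?(negPf uX) ?andbF.
Qed.

(** * Deleting and adding edges, irreducibility, and edge counts at barriers *)

Section Operations.
Variables (V E : finType).
Implicit Types (g : E -> V * V) (X Y Z R T : {set V}) (F : {set {set V}}) (M : {set E}).

Definition del g M : E -> V * V := fun e => if e \in M then ((g e).1, (g e).1) else g e.

Lemma bd_del g M X : bd (del g M) X = bd g X :\: M.
Proof. by apply/setP => e; rewrite !inE /del; case: ifP; rewrite //= eqxx. Qed.

Lemma cut_del g M X : cut (del g M) X + #|M :&: bd g X| = cut g X.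
Proof. by rewrite /cut bd_del setIC addnC cardsID. Qed.

Lemma slack_del g M k X : (forall v, vdeg g v <= k) ->
  slack (del g M) k X = slack g k X + \sum_(v in X) #|M :&: bd g [set v]|.
Proof.
move=> dk; rewrite -big_split; apply: eq_bigr => v _ /=.
by have := cut_del g M [set v]; have := dk v; rewrite /vdeg; lia.
Qed.

(** Each edge lost by the cut of [X] has an end in [X], whose slack grows by one. *)
Lemma good_del g M k : good g k -> good (del g M) k.
Proof.
move=> [dk gk]; split=> [v|X oX].
  by apply: leq_trans (dk v); rewrite /vdeg -(cut_del g M) leq_addr.
rewrite slack_del //; have := gk X oX; have := cut_del g M X.
by have := cardI_bd g X M; lia.
Qed.

Definition matching g M := forall v, #|M :&: bd g [set v]| <= 1.

Lemma kcol_del g M k : matching g M -> kcol (del g M) k -> kcol g k.+1.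
Proof.
move=> mM [c Hc]; exists (fun e => if e \in M then k else c e) => v e ev.
have H f : f \in bd g [set v] -> f \notin M -> c f < k /\
    forall f', f' \in bd g [set v] -> f' \notin M -> c f = c f' -> f = f'.
  move=> fv fM; have [] := Hc v f; first by rewrite bd_del inE fM.
  by move=> lt inj; split=> // f' fv' fM'; apply: inj; rewrite bd_del inE fM'.
case: (boolP (e \in M)) => eM; split=> //.
- move=> f fv; case: (boolP (f \in M)) => fM E'; last by have [] := H f fv fM; rewrite -E' ltnn.
  have /card_le1_eqP := mM v; apply; by rewrite inE ?eM ?fM.
- by have [/ltnW] := H e ev eM.
- move=> f fv; case: (boolP (f \in M)) => fM E'; first by have [] := H e ev eM; rewrite E' ltnn.
  by have [_ inj] := H e ev eM; apply: inj.
Qed.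

Definition addE g a b : option E -> V * V := oapp g (a, b).

Lemma cut_addE g a b X : cut (addE g a b) X = cut g X + ((a \in X) != (b \in X)).
Proof.
rewrite /cut -!sum1_card addnC (bigID (pred1 None)) /=; congr addn.
  rewrite (eq_bigl (fun e => (e == None) && ((a \in X) != (b \in X)))); last first.
    by case=> [e|]; rewrite !inE ?andbF ?andbT.
  case: ((a \in X) != (b \in X)); first by rewrite (big_pred1 None) // => e; rewrite andbT.
  by rewrite big_pred0 // => e; rewrite andbF.
rewrite (reindex_omap Some id) /=; last by case=> [e|]; rewrite ?andbF.
by apply: eq_bigl => e; rewrite !inE !eqxx !andbT.
Qed.

Lemma kcol_addE g a b k : kcol (addE g a b) k -> kcol g k.
Proof.
move=> [c Hc]; exists (c \o Some) => v e ev; have [] := Hc v (Some e); first by move: ev; rewrite !inE.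
move=> lt inj; split=> // f fv /= ecf.
by have [] : Some e = Some f by apply: inj => //; move: fv; rewrite !inE.
Qed.

Lemma deg_addE g a b v : a != b -> vdeg (addE g a b) v = vdeg g v + (v == a) + (v == b).
Proof.
move=> nab; rewrite /vdeg cut_addE !inE -addnA [a == v]eq_sym [b == v]eq_sym; congr addn.
by case: (v =P a) => [->|]; [rewrite (negPf nab)|case: (v == b)].
Qed.

Lemma slack_addE g a b k X : a != b -> vdeg g a < k -> vdeg g b < k ->
  slack (addE g a b) k X + (a \in X) + (b \in X) = slack g k X.
Proof.
move=> nab ka kb.
rewrite -!sum_eq_mem -!big_split; apply: eq_bigr => v _ /=; rewrite deg_addE //.
case: (v =P a) => [->|_]; first by rewrite (negPf nab); lia.
by case: (v =P b) => [->|_]; lia.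
Qed.

(** Only odd sets containing both ends lose anything. They lose 2, and by parity a set that is not
    tight has 2 to spare. *)
Lemma good_addE g a b k : good g k -> a != b -> vdeg g a < k -> vdeg g b < k ->
    (forall X, odd #|X| -> a \in X -> b \in X -> cut g X + slack g k X != k) ->
  good (addE g a b) k.
Proof.
move=> [dk gk] nab ka kb nt; split=> [v|X oX].
  rewrite deg_addE //; case: (v =P a) => [->|_]; first by rewrite (negPf nab); lia.
  by case: (v =P b) => [->|_]; have := dk v; lia.
have := slack_addE X nab ka kb; rewrite cut_addE; have := gk X oX.
case: (boolP (a \in X)) => aX; case: (boolP (b \in X)) => bX /=; try lia.
have := nt X oX aX bX; have := odd_excess dk oX; move: (slack g k X) (cut g X) => S C; lia.
Qed.

(** The margin [s] ensures that contracting one of the excluded sets would create a vertex of slack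
    at least [s]. *)
Definition irreducible g k s := forall Z, odd #|Z| -> 3 <= #|Z| -> 3 <= #|~: Z| ->
  cut g Z + s <= k -> ~~ flat g k Z.

(** A tight set minimises [cut + slack], and passing from [X] to [R] changes the slack by at most
    [dist]. *)
Lemma tight_flat g k X : good g k -> cut g X + slack g k X = k -> flat g k X.
Proof.
move=> [_ gk] eX; apply/flatP => R oR.
by have := gk R oR; have := slack_dist g k R X; lia.
Qed.

Lemma odd_compl X : ~~ odd #|V| -> odd #|~: X| = odd #|X|.
Proof. by move=> oV; have /(congr1 odd) := cardsC X; rewrite oddD (negPf oV); case: odd; case: odd. Qed.

(** A tight set containing both ends has slack at least [t + t], hence cut at most [k - s], and
    would be a forbidden flat set. If it missed just one vertex, that vertex would have more slack
    than [w]. *)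
Lemma good_join g k s t w a : good g k -> ~~ odd #|V| -> irreducible g k s ->
    (forall v, k - vdeg g v <= k - vdeg g w) -> a != w -> 0 < t -> t <= k - vdeg g a ->
    s <= t + t -> good (addE g w a) k.
Proof.
move=> G oV irr wmax naw t0 ta st; have wa := wmax a.
apply: good_addE => //; try lia; first by rewrite eq_sym.
move=> X oX wX aX; apply/eqP => tight.
have sX : k - vdeg g w + (k - vdeg g a) <= slack g k X.
  rewrite (slackD1 g k wX) leq_add2l (slackD1 g k (v := a)) ?leq_addr //.
  by rewrite !inE naw.
have X2 : 2 <= #|X|.
  have <- : #|[set w; a]| = 2 by rewrite cards2 eq_sym naw.
  by apply: subset_leq_card; rewrite subUset !sub1set wX.
have oC : odd #|~: X| by rewrite odd_compl.
have [C1|C3] : #|~: X| = 1 \/ 3 <= #|~: X| by move: oC; case: #|~: X| => [|[|[|n]]] //; auto.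
- have /cards1P[v vE] : #|~: X| == 1 by rewrite C1.
  have dv := G.1 v; have da := G.1 a; have cX : cut g X = vdeg g v by rewrite -cutC vE.
  have := wmax v; lia.
- have X3 : 3 <= #|X| by move: X2 oX; case: #|X| => [|[|[|]]].
  have cs : cut g X + s <= k by lia.
  by have := irr X oX X3 C3 cs; rewrite (tight_flat G tight).
Qed.

(* Minimising [cut R + dist R Z] over odd [R] produces a flat set; if none is
   nontrivial, the minimiser is a vertex or the complement of one. *)
Lemma irreducible_dominated g k s Z : good g k -> ~~ odd #|V| -> irreducible g k s ->
    odd #|Z| -> 3 <= #|Z| -> 3 <= #|~: Z| -> cut g Z + s <= k -> cut g Z <= k ->
  exists v Y, [/\ Y = Z \/ Y = ~: Z, v \in Y & vdeg g v + slack g k (Y :\ v) < cut g Z].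
Proof.
move=> G oV irr oZ Z3 C3 cs ck.
case: (arg_minnP (P := fun R : {set V} => odd #|R|) (fun R => cut g R + dist g k R Z) oZ) => R oR Rmin.
have minflat (Q : {set V}) : odd #|Q| -> cut g Q + dist g k Q Z <= cut g R + dist g k R Z -> flat g k Q.
  move=> oQ le; apply/flatP => P oP; have := Rmin P oP; have := dist_tri g k P Q Z; lia.
have d0 : dist g k Z Z = 0 by rewrite dist_sub // setDv /slack big_set0.
have Zle := Rmin Z oZ; rewrite d0 addn0 in Zle.
have Zlt : cut g R + dist g k R Z < cut g Z.
  rewrite ltnNge; apply/negP => le; have := irr Z oZ Z3 C3 cs.
  by rewrite minflat // d0 addn0.
have fR : flat g k R by apply: minflat.
have oCR : odd #|~: R| by rewrite odd_compl.
have cR : cut g R + s <= k by lia.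
have [R1|C1] : #|R| = 1 \/ #|~: R| = 1.
  have := irr R oR; rewrite fR; move: oR oCR.
  case: #|R| => [|[|[|n]]] //; first by left.
  case: #|~: R| => [|[|[|n']]] //; first by right.
  by move=> _ _ H; have := H isT isT cR.
- have /cards1P[v vE] : #|R| == 1 by rewrite R1.
  have vZ : v \in Z.
    apply: contraLR Zlt => vZ; rewrite -leqNgt vE; have := dist1_notin g k vZ.
    by have := G.1 v; rewrite /vdeg; lia.
  exists v, Z; split; auto.
  by rewrite /vdeg -(dist1 g k vZ) -vE.
- have /cards1P[v vE] : #|~: R| == 1 by rewrite C1.
  rewrite -distCC vE -(cutC g R) vE in Zlt.
  have vZ : v \in ~: Z.
    apply: contraLR Zlt => vZ; rewrite -leqNgt; have := dist1_notin g k vZ.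
    by have := G.1 v; rewrite /vdeg; lia.
  exists v, (~: Z); split; auto.
  by rewrite /vdeg -(dist1 g k vZ).
Qed.

Definition adj g : rel V := fun x y =>
  (x != y) && [exists e, (e \in bd g [set x]) && (e \in bd g [set y])].

Lemma adj_sym g : symmetric (adj g).
Proof. by move=> x y; rewrite /adj eq_sym; congr andb; apply: eq_existsb => e; rewrite andbC. Qed.

Lemma adj_irr g : irreflexive (adj g).
Proof. by move=> x; rewrite /adj eqxx. Qed.

Lemma in_bd1 g v e :
  (e \in bd g [set v]) = ((g e).1 != (g e).2) && ((v == (g e).1) || (v == (g e).2)).
Proof.
rewrite !inE ![_ == v]eq_sym; have [->|n1] := eqVneq v (g e).1; first by case: ((g e).1 == (g e).2).
by have [<-|_] /= := eqVneq v (g e).2; rewrite ?andbF // eq_sym n1.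
Qed.

Lemma bd_ends g x y v e : x != y -> e \in bd g [set x] -> e \in bd g [set y] ->
  e \in bd g [set v] -> v = x \/ v = y.
Proof.
move=> nxy; rewrite !in_bd1.
move=> /andP[_ /pred2P[] ex] /andP[_ /pred2P[] ey] /andP[_ /pred2P[] ev];
  by rewrite ?ex ?ey ?ev ?eqxx in nxy *; auto.
Qed.

(** One edge is chosen for each adjacent pair of [m]. Nonadjacent pairs are allowed: [M] misses
    exactly their vertices. *)
Lemma adj_matching g m : involutive m ->
  exists M, forall v, #|M :&: bd g [set v]| = adj g v (m v).
Proof.
move=> mK.
pose pk x := [pick e | (e \in bd g [set x]) && (e \in bd g [set m x])].
have pkm x : pk (m x) = pk x by apply: eq_pick => e; rewrite mK andbC.
exists [set e | [exists x, (x != m x) && (pk x == Some e)]] => v.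
case: (boolP (adj g v (m v))) => av; last first.
  apply: eq_card0 => e; rewrite !inE; apply/negP => /andP[/existsP[x /andP[nx /eqP]]].
  rewrite /pk; case: pickP => // e' /andP[ex emx] [ee'] ev; rewrite {}ee' in ex emx.
  have ax : adj g x (m x) by rewrite /adj nx; apply/existsP; exists e; rewrite ex.
  have [|vx|vx] := @bd_ends g x (m x) v e nx ex emx; first by rewrite !inE.
    by rewrite vx ax in av.
  by rewrite vx mK adj_sym ax in av.
move: (av); rewrite /adj => /andP[nv /existsP[e0 e0P]].
case E0 : (pk v) => [e1|]; last by move: E0; rewrite /pk; case: pickP => // /(_ e0); rewrite e0P.
apply: (@eq_card1 _ e1) => e; rewrite !inE; apply/andP/eqP => [[/existsP[x /andP[nx /eqP ex]] ev]|->].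
  have : pk v = Some e; last by rewrite E0 => -[].
  rewrite -ex; move: ex; rewrite {1}/pk; case: pickP => // e' /andP[e'x e'mx] [ee'].
  rewrite {}ee' in e'x e'mx.
  have [|->|->] := @bd_ends g x (m x) v e nx e'x e'mx; rewrite ?inE ?pkm //.
have e1v : e1 \in bd g [set v].
  by move: E0; rewrite /pk; case: pickP => // e' /andP[e'v _] [<-].
split; last by move: e1v; rewrite !inE.
by apply/existsP; exists v; rewrite nv E0 eqxx.
Qed.

(** An edge leaving a member of [F] ends in [T], so it lies in the cut of no second member. *)
Lemma barrier_cuts g F T : trivIset F -> (forall C, C \in F -> [disjoint C & T]) ->
    (forall C x y, C \in F -> x \in C -> adj g x y -> y \in C :|: T) ->
  \sum_(C in F) cut g C <= \sum_(t in T) vdeg g t.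
Proof.
move=> tF dF cF; rewrite /vdeg /cut.
under eq_bigr => C _ do rewrite -sum1_card big_mkcond.
under [leqRHS]eq_bigr => t _ do rewrite -sum1_card big_mkcond.
rewrite exchange_big [leqRHS]exchange_big /=; apply: leq_sum => e _.
have [->//|] := posnP (\sum_(C in F) (if e \in bd g C then 1 else 0)).
rewrite lt0n sum_nat_eq0 negb_forall => /existsP[C]; rewrite negb_imply => /andP[CF].
case: ifP => // eC _.
have [x xC ex] := bd_cover eC.
have : e \in bd g (~: C) by rewrite bdC.
case/bd_cover => y; rewrite inE => yC ey.
have nxy : x != y by apply: contraNneq yC => <-.
have yT : y \in T.
  have : y \in C :|: T.
    by apply: cF CF xC _; rewrite /adj nxy; apply/existsP; exists e; rewrite ex.
  by rewrite inE (negPf yC).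
rewrite [leqRHS](bigD1 y) //= ey; apply: leq_trans (leq_addr _ _).
rewrite (bigD1 C) //= eC big1 // => C' /andP[C'F nC']; case: ifP => // eC'.
have [z zC' ez] := bd_cover eC'.
have [zE|zE] := bd_ends nxy ex ey ez.
  have := trivIsetP tF C C' CF C'F; rewrite eq_sym nC' => /(_ isT) /disjointFr /(_ xC).
  by rewrite -zE zC'.
by have := disjointFr (dF C' C'F) zC'; rewrite zE yT.
Qed.

Lemma sum_cut_bound g F r lo b : (forall C, C \in F -> lo <= cut g C) ->
    #|[set C in F | cut g C < r]| <= b ->
  r * #|F| <= \sum_(C in F) cut g C + b * (r - lo).
Proof.
move=> lF bF; rewrite mulnC -sum_nat_const.
apply: leq_trans (_ : \sum_(C in F) (cut g C + (cut g C < r) * (r - lo)) <= _).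
  by apply: leq_sum => C CF; have := lF C CF; case: (ltnP (cut g C) r); lia.
rewrite big_split leq_add2l -big_distrl leq_mul2r; apply/orP; right.
by apply: leq_trans bF; rewrite -big_mkcondr sum1dep_card.
Qed.

End Operations.

Lemma vdeg_contract_Some (V E : finType) (g : E -> V * V) Z u :
  vdeg (contract g Z) (Some u) = vdeg g (val u).
Proof. by rewrite /vdeg /cut bd_contract_Some. Qed.

Lemma vdeg_contract_None (V E : finType) (g : E -> V * V) Z :
  vdeg (contract g Z) None = cut g Z.
Proof. by rewrite /vdeg /cut bd_contract_None. Qed.

Lemma slack_contract (V E : finType) (g : E -> V * V) k (Z : {set V}) :
  slack (contract g Z) k [set: _] = k - cut g Z + slack g k Z.
Proof.
rewrite /slack sum_option inE mul1n vdeg_contract_None; congr addn.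
apply: eq_big => [v|v]; rewrite inE andbT // => vZ.
by rewrite (insubT (fun v => v \in Z) vZ) vdeg_contract_Some.
Qed.

(** Induction on [#|V| + slack]: contract a nontrivial flat set, or join a vertex [w] of largest
    slack to another vertex of slack at least [t]. When neither is possible, [Hfin] takes over. The
    types are quantified because both operations change them. *)
Lemma normalise (Inv : forall V E : finType, (E -> V * V) -> Prop) s t k C :
    0 < t -> s <= t + t ->
    (forall (V E : finType) (g : E -> V * V) (Z : {set V}), Inv V E g -> ~~ odd #|V| -> good g k ->
       odd #|Z| -> 3 <= #|~: Z| -> cut g Z + s <= k -> Inv _ _ (contract g Z)) ->
    (forall (V E : finType) (g : E -> V * V) a b, Inv V E g -> a != b ->
       t <= k - vdeg g a -> t <= k - vdeg g b -> Inv _ _ (addE g a b)) ->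
    (forall (V E : finType) (g : E -> V * V) w, Inv V E g -> ~~ odd #|V| -> good g k ->
       irreducible g k s -> (forall v, v != w -> k - vdeg g v < t) -> kcol g C) ->
  forall (V E : finType) (g : E -> V * V), Inv V E g -> ~~ odd #|V| -> good g k -> kcol g C.
Proof.
move=> t0 st Hdiv Hadd Hfin V E g.
have [n] := ubnP (#|V| + slack g k [set: V]).
elim: n V E g => // n IH V E g lt I oV G.
case: (boolP [exists Z : {set V}, [&& odd #|Z|, 3 <= #|Z|, 3 <= #|~: Z|, cut g Z + s <= k & flat g k Z]]).
  case/existsP => Z /and5P[oZ Z3 C3 cs fZ].
  have step (Y : {set V}) : odd #|Y| -> 3 <= #|Y| -> 3 <= #|~: Y| -> cut g Y + s <= k -> flat g k Y ->
      kcol (contract g Y) C.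
    move=> oY Y3 CY3 cY fY; apply: IH.
    (* Goodness of [~: Y] shows that the new vertex has no more slack than the vertices it
       replaces. *)
    - rewrite slack_contract card_option card_sig.
      have := cardsC Y; have := slackC g k Y; have := G.2 (~: Y); rewrite cutC odd_compl // => /(_ oY).
      by have -> : #|[pred x in Y]| = #|Y| by []; lia.
    - exact: Hdiv.
    - rewrite card_option card_sig /= negbK.
      by have -> : #|[pred x in Y]| = #|Y| by [].
    - by apply: good_contract => //; lia.
  apply: (kcol_merge (Z := Z)); apply: step; rewrite ?cutC ?setCK ?odd_compl //.
  exact: flatC.
rewrite negb_exists => /forallP noZ.
have irr : irreducible g k s.
  by move=> Z oZ Z3 C3 cs; have := noZ Z; rewrite oZ Z3 C3 cs.
case: (pickP (fun _ : V => true)) => [x0 _|V0]; last by exists (fun=> 0) => v; have := V0 v.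
case: (arg_maxnP (P := xpredT) (i0 := x0) (fun v => k - vdeg g v) isT) => w _ wmax.
case: (boolP [exists a, (a != w) && (t <= k - vdeg g a)]) => [/existsP[a /andP[naw ta]]|].
  have wa := wmax a isT; rewrite /= in wa.
  have wmax' v : k - vdeg g v <= k - vdeg g w by apply: wmax.
  apply: (kcol_addE (a := w) (b := a)); apply: IH => //.
  - have := @slack_addE V E g w a k [set: V]; rewrite !inE eq_sym naw => /(_ isT).
    by lia.
  - by apply: Hadd => //; [rewrite eq_sym|apply: leq_trans wa].
  - exact: (good_join G oV irr wmax' naw t0 ta st).
rewrite negb_exists => /forallP noa.
apply: (Hfin V E g w) => // v nvw; have := noa v; rewrite nvw /= -ltnNge; exact.
Qed.

(** The complement of [w] has no slack, so its cut, the degree of [w], is at least [k]. *)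
Lemma regular_of_saturated (V E : finType) (g : E -> V * V) k w :
    good g k -> ~~ odd #|V| -> (forall v, v != w -> k - vdeg g v < 1) ->
  forall v, vdeg g v = k.
Proof.
move=> [dk gk] oV H.
have H' v : v != w -> vdeg g v = k by move=> /H; have := dk v; lia.
move=> v; have [->|/H' //] := eqVneq v w.
have oC : odd #|~: [set w]| by rewrite odd_compl // cards1.
have := gk _ oC; rewrite cutC /slack big1; first by have := dk w; rewrite /vdeg; lia.
by move=> u; rewrite !inE => /H' ->; rewrite subnn.
Qed.

(** The base of the descent. After normalisation the multigraph is regular and has no barrier, and
    its nontrivial odd cuts are not tight, so a perfect matching can be removed. *)
Lemma kcol_small k (V E : finType) (g : E -> V * V) :
  (#|V| <= 8) || (k <= 2) -> ~~ odd #|V| -> good g k -> kcol g k.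
Proof.
elim: k V E g => [|k IH] V E g.
  move=> _ _ [d0 _]; exists (fun=> 0) => v e ev; have := d0 v.
  by rewrite leqn0 cards_eq0 => /eqP E0; rewrite E0 inE in ev.
move=> small oV G.
pose Inv (V E : finType) (_ : E -> V * V) := (#|V| <= 8) || (k.+1 <= 2) : Prop.
have I : Inv V E g by [].
move: {small} V E g I oV G; apply: (@normalise Inv 0 1 k.+1 k.+1) => //.
  move=> V E g Z; rewrite /Inv => I oV G oZ C3 _.
  case/orP: I => [V8|->]; rewrite ?orbT // card_option card_sig.
  have -> : #|[pred x in Z]| = #|Z| by [].
  by have := cardsC Z; lia.
move=> V E g w I oV G irr H.
have reg := regular_of_saturated G oV H.
have [[m [mK em]]|[T [F [[tF oF cF _] TF]]]] := tutte_barrier (@adj_sym V E g) (@adj_irr V E g) oV; last first.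
  have dF C : C \in F -> [disjoint C & T] by move=> /oF[].
  have := barrier_cuts tF dF cF.
  under [leqRHS]eq_bigr => t _ do rewrite reg.
  rewrite sum_nat_const.
  have : \sum_(C in F) k.+1 <= \sum_(C in F) cut g C.
    apply: leq_sum => C CF; have [oC _] := oF C CF; have := G.2 C oC.
    by rewrite /slack big1 ?addn0 // => v _; rewrite reg subnn.
  by rewrite sum_nat_const; nia.
have [M HM] := adj_matching g mK.
have {em}HM v : #|M :&: bd g [set v]| = 1 by rewrite HM em.
apply: (@kcol_del _ _ _ M); first by move=> v; rewrite HM.
have d' v : vdeg (del g M) v = k.
  by have := cut_del g M [set v]; rewrite HM -!/(vdeg _ v) reg; lia.
apply: IH => //.
  by case/orP: I => [->//|/ltnW ->]; rewrite orbT.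
split=> [v|X oX]; first by rewrite d'.
have cX := cut_del g M X; have mX := cardI_bd g X M.
have mCX := cardI_bd g (~: X) M; rewrite bdC in mCX.
move: mX mCX; under eq_bigr => v _ do rewrite HM.
under [X in _ -> _ <= X -> _]eq_bigr => v _ do rewrite HM.
rewrite !sum1_card => mX mCX.
apply: leq_trans (leq_addr _ _).
have oC : odd #|~: X| by rewrite odd_compl.
have triv v : cut (del g M) [set v] = k by have := d' v.
have [X1|C1|[X3 C3]] : [\/ #|X| = 1, #|~: X| = 1 | 3 <= #|X| /\ 3 <= #|~: X|].
  move: oX oC; case: #|X| => [|[|[|n]]] //; first by constructor 1.
  by case: #|~: X| => [|[|[|n']]] //; [constructor 2|constructor 3].
- have /cards1P[v ->] : #|X| == 1 by rewrite X1.
  by rewrite triv.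
- have /cards1P[v vE] : #|~: X| == 1 by rewrite C1.
  by rewrite -cutC vE triv.
have par : odd (cut g X) = odd k.+1.
  rewrite odd_cut; under eq_bigr => v _ do rewrite reg.
  by rewrite sum_nat_const oddM oX.
have s0 : slack g k.+1 X = 0 by rewrite /slack big1 // => v _; rewrite reg subnn.
have ge : k.+1 <= cut g X by have := G.2 X oX; rewrite s0 addn0.
have ne : cut g X != k.+1.
  apply/eqP => tight; have := irr X oX X3 C3; rewrite (tight_flat G) ?tight ?s0 ?addn0 //.
  by move=> /(_ (leqnn _)).
have ge3 : k.+3 <= cut g X.
  move: ge ne par; rewrite leq_eqVlt eq_sym => /orP[->//|]; rewrite leq_eqVlt => /orP[/eqP <- _|//].
  by rewrite /= negbK; case: odd.
(* With at most 8 vertices one side has at most 3, so [M] takes at most 3 edges of the cut. With a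
   tiny palette, parity alone suffices. *)
case/orP: I => [V8|k2].
  have := cardsC X; have : #|X| <= 3 \/ #|~: X| <= 3; last by case; lia.
  have := cardsC X; case: (leqP #|X| 3) => X4; first by left.
  move=> cV; right; lia.
have [->//|k1] : k = 0 \/ k = 1 by lia.
have : odd (cut (del g M) X).
  rewrite odd_cut; under eq_bigr => v _ do rewrite d'.
  by rewrite sum_nat_const oddM oX k1.
by rewrite k1; case: cut.
Qed.

(** * Descent on the palette *)

(* The last condition is [min (n / 3) k < (3 / 2) ^ (J + 1)], without denominators. *)
Definition excess_bound J := forall (V E : finType) (g : E -> V * V) k,
  good g k -> ~~ odd #|V| -> minn #|V| (3 * k) * 2 ^ J.+1 < 3 ^ J.+2 -> kcol g (k + J).

Lemma card_odd_cases (V : finType) (X : {set V}) : ~~ odd #|V| -> odd #|X| ->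
  [\/ exists v, X = [set v], exists v, ~: X = [set v] | 3 <= #|X| /\ 3 <= #|~: X|].
Proof.
move=> oV oX; have oC : odd #|~: X| by rewrite odd_compl.
have [/eqP/cards1P[v vE]|X1] := eqVneq #|X| 1; first by constructor 1; exists v.
have [/eqP/cards1P[v vE]|C1] := eqVneq #|~: X| 1; first by constructor 2; exists v.
constructor 3; move: oX X1 oC C1; case: #|X| => [|[|[|a]]] //.
by case: #|~: X| => [|[|[|b]]].
Qed.

Lemma leq_card_slack (V E : finType) (g : E -> V * V) k (X : {set V}) : (forall v, vdeg g v < k) ->
  #|X| <= slack g k X.
Proof. by move=> dk; rewrite -sum1_card; apply: leq_sum => v _; have := dk v; lia. Qed.

(** The count for a barrier [T] containing [w]: [t] is [#|T :\ w|], [u] the number of full vertices,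
    [d] the degree of [w], [a] the degree sum over [T :\ w], [b] the sum of the cuts, [f] is
    [#|F|]. *)
Lemma barrier_count k t u d a b f : a <= k * t + u -> b <= d + a ->
  k * f <= b + (k - d) -> d <= k -> t + 3 <= f -> 2 * k <= u.
Proof.
move=> h1 h2 h3 h4 /(leq_mul (leqnn k)); rewrite mulnDr; lia.
Qed.

(** * The inductive step, from [J] and [J.+1] to [J.+2] *)

Section Stage.
Variables (J n m : nat).
Hypothesis HA0 : excess_bound J.
Hypothesis HA1 : excess_bound J.+1.
Hypothesis m9 : 9 <= m.
Hypothesis mJ : m * 2 ^ J.+3 < 3 ^ J.+4.

(** To avoid denominators, [m] will be [minn n (3 * k)]. Each factor [2/3] saves one colour: order
    [4/9 m] falls under [excess_bound J], while order [2/3 m] or palette [2/9 m] falls under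
    [excess_bound J.+1]. *)
Lemma kcol_part (V E : finType) (g : E -> V * V) k :
  9 * #|V| <= 4 * m -> ~~ odd #|V| -> good g k -> kcol g (k + J).
Proof.
move=> Vm oV G; apply: HA0 => //.
have := geq_minl #|V| (3 * k); move: mJ; rewrite !expnS.
set q := 2 ^ J; set p := 3 ^ J; nia.
Qed.

Lemma kcol_part1 (V E : finType) (g : E -> V * V) k :
  3 * #|V| <= 2 * m -> ~~ odd #|V| -> good g k -> kcol g (k + J.+1).
Proof.
move=> Vm oV G; apply: HA1 => //.
have := geq_minl #|V| (3 * k); move: mJ; rewrite !expnS.
set q := 2 ^ J; set p := 3 ^ J; nia.
Qed.

Lemma kcol_palette (V E : finType) (g : E -> V * V) k :
  9 * k <= 2 * m -> ~~ odd #|V| -> good g k -> kcol g (k + J.+1).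
Proof.
move=> Vm oV G; apply: HA1 => //.
have := geq_minr #|V| (3 * k); move: mJ; rewrite !expnS.
set q := 2 ^ J; set p := 3 ^ J; nia.
Qed.

(* With [K.+1] colours, a vertex of degree [K] has used up one of its two spare colours.
   Each step creates at most one such vertex, and [K0 - K] is the number of steps made. *)
Lemma kcol_two_spare K K0 (V E : finType) (g : E -> V * V) :
    3 * K0 <= m + 3 -> (forall v, vdeg g v <= K) ->
    #|[set v | vdeg g v == K]| + K <= K0 -> ~~ odd #|V| -> good g K.+1 ->
  kcol g (K.+1 + J).
Proof.
move=> K0m; elim: K V E g => [|K' IH] V E g dK UK oV G.
  exists (fun=> 0) => v e ev; have := dK v.
  by rewrite leqn0 cards_eq0 => /eqP E0; rewrite E0 inE in ev.
move: dK UK => dK0 UK0.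
pose K := K'.+1.
pose Inv (V E : finType) (g : E -> V * V) :=
  (forall v, vdeg g v <= K) /\ #|[set v | vdeg g v == K]| + K <= K0.
have I : Inv V E g by [].
move: I oV G; clear dK0 UK0; move: V E g.
(* With margin 2 a contracted side gets degree below [K]; with threshold 3 a joined vertex stays
   below [K]. So neither operation adds a vertex of degree [K]. *)
apply: (@normalise Inv 2 3 K.+1 (K.+1 + J)) => //.
- move=> V E g Z [dK UK] oV G oZ C3 cs; split.
    case=> [u|]; first by rewrite vdeg_contract_Some.
    by rewrite vdeg_contract_None; lia.
  apply: leq_trans UK; rewrite leq_add2r card_preim_contract inE vdeg_contract_None.
  have -> : (cut g Z == K) = false by apply/eqP; lia.
  rewrite add0n; apply: subset_leq_card; apply/subsetP => v; rewrite !inE => /andP[dv vZ].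
  by move: dv; rewrite (insubT (fun v => v \in Z) vZ) vdeg_contract_Some.
- move=> V E g a b [dK UK] nab ta tb; split.
    move=> v; rewrite deg_addE //; have := dK v.
    case: (v =P a) => [->|_]; first by rewrite (negPf nab); lia.
    by case: (v =P b) => [->|_]; lia.
  apply: leq_trans UK; rewrite leq_add2r; apply: subset_leq_card.
  apply/subsetP => v; rewrite !inE deg_addE //.
  case: (v =P a) => [->|_]; first by rewrite (negPf nab); lia.
  by case: (v =P b) => [->|_]; lia.
move=> V E g w [dK UK] oV G irr H.
have [Vm|Vm] := leqP (9 * #|V|) (4 * m); first exact: kcol_part.
(* Since [9 <= m], one has [9 * K0 <= 3 * m + 9 <= 4 * m]. *)
have VK0 : K0 < #|V| by lia.
set U := [set v | vdeg g v == K] in UK.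
have dw v : v != w -> K <= (vdeg g v).+1 by move=> /H; lia.
have dKS v : vdeg g v < K.+1 by have := dK v.
have NU : K.+1 <= #|~: U| by have := cardsC U; lia.
have slK X : slack g K.+1 X = slack g K X + #|X|.
  rewrite -sum1_card -big_split; apply: eq_bigr => v _ /=.
  by have := dK v; lia.
have slKV v : K <= slack g K (~: [set v]).
  apply: leq_trans (_ : #|~: U :\ v| <= _); first by have := cardsD1 v (~: U); case: (_ \in _); lia.
  rewrite -sum1_card; apply: leq_trans (_ : \sum_(u in ~: U :\ v) (K - vdeg g u) <= _).
    by apply: leq_sum => u; rewrite !inE => /andP[_ du]; have := dK u; lia.
  by apply: slackS; apply/subsetP => u; rewrite !inE => /andP[].
(* A vertex other than [w] cannot dominate: its degree is at least [K.-1], and its side contributes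
   two more units of slack. *)
have dom (Z : {set V}) : odd #|Z| -> 3 <= #|Z| -> 3 <= #|~: Z| -> cut g Z < K ->
    exists Y, [/\ Y = Z \/ Y = ~: Z, w \in Y & vdeg g w + slack g K.+1 (Y :\ w) < cut g Z].
  move=> oZ Z3 C3 cK; have [| |v [Y [YZ vY lt]]] := irreducible_dominated G oV irr oZ Z3 C3; try lia.
  exists Y; have Y3 : 2 < #|Y| by case: YZ => ->.
  have := leq_card_slack (Y :\ v) dKS; have := cardsD1 v Y; rewrite vY => cY le.
  by have [vw|/dw dv] := eqVneq v w; [rewrite -vw|lia].
have exc (C : {set V}) : odd #|C| -> w \notin C -> cut g C < K.-1 -> vdeg g w + slack g K.+1 (~: C :\ w) <= cut g C.
  move=> oC wC cK; have [[v vE]|[v vE]|[C3 CC3]] := card_odd_cases oV oC.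
  - have vw : v != w by apply: contraNneq wC => <-; rewrite vE set11.
    by have := dw v vw; rewrite /vdeg -vE; lia.
  - have /eqP vw : w == v by rewrite -in_set1 -vE inE.
    by rewrite vE vw setDv /slack big_set0 addn0 /vdeg -vE cutC.
  - have [|Y [YC wY lt]] := dom C oC C3 CC3; first by lia.
    by case: YC wY lt => -> wY lt; [rewrite wY in wC|exact: ltnW].
have lo (C : {set V}) : odd #|C| -> (K.-1 <= cut g C) || (vdeg g w <= cut g C).
  move=> oC; case: leqP => //= cK; have [[v vE]|[v vE]|[C3 CC3]] := card_odd_cases oV oC.
  - have [vw|/dw dv] := eqVneq v w; first by rewrite /vdeg -vw -vE.
    by move: cK; rewrite vE; rewrite /vdeg in dv; lia.
  - have [vw|/dw dv] := eqVneq v w; first by rewrite /vdeg -vw -vE cutC.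
    by move: cK; rewrite -cutC vE; rewrite /vdeg in dv; lia.
  - have [|Y [YC wY lt]] := dom C oC C3 CC3; first by lia.
    by lia.
(* The slack of the many vertices of degree below [K] makes [g] good for [K] already. Hence any
   matching may be deleted later, and only degrees need care. *)
have GK : good g K.
  split=> // X oX; have [[v ->]|[v vE]|[X3 C3]] := card_odd_cases oV oX.
  - by rewrite slack1 /vdeg; lia.
  - have -> : X = ~: [set v] by rewrite -vE setCK.
    exact: leq_trans (slKV v) (leq_addl _ _).
  - have [|cK] := leqP K (cut g X); first by move=> le; apply: leq_trans (leq_addr _ _).
    have [Y [YX wY lt]] := dom X oX X3 C3 cK; case: YX wY lt => -> wY lt.
      by rewrite (slackD1 g K wY); have := dK w; lia.
    have := slKV w; have : slack g K (~: [set w]) = slack g K X + slack g K (~: X :\ w).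
      rewrite -slackU; last first.
        by rewrite -setI_eq0; apply/eqP/setP => u; rewrite !inE; case: (u \in X); rewrite ?andbF.
      congr slack; apply/setP => u; rewrite !inE; case: (u =P w) => [->|_] /=.
        by move: wY; rewrite inE => /negPf->.
      by case: (u \in X).
    by have := slK (~: X :\ w); lia.
have [Km|Km] := leqP (9 * K) (2 * m).
  by have := kcol_palette Km oV GK; rewrite addnS addSn.
pose N := [set v | (v != w) && (vdeg g v < K)].
pose act := (vdeg g w).+1 < K.
(* The additional pairs allow a matching that misses [w] and one vertex of [N]. *)
pose e x y := adj g x y || act && ((x == w) && (y \in N) || (y == w) && (x \in N)).
have esym : symmetric e.
  by move=> x y; rewrite /e adj_sym; congr (_ || (_ && _)); rewrite orbC.
have eirr : irreflexive e.
  move=> x; rewrite /e adj_irr /= !inE; case: (x =P w); rewrite ?andbF //.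
have adje x y : adj g x y -> e x y by rewrite /e => ->.
(* By [2 * m < 9 * K], the vertices of degree [K] are too few to feed two surplus members of a
   barrier. *)
have UB : #|U| + 2 < 2 * K by lia.
have [[m' [mK em]]|[T [F [[tF oF cF _] TF]]]] := tutte_barrier esym eirr oV; last first.
  have dF C : C \in F -> [disjoint C & T] by move=> /oF[].
  have caF C x y : C \in F -> x \in C -> adj g x y -> y \in C :|: T.
    by move=> CF xC /adje; apply: cF.
  have sums := barrier_cuts tF dF caF.
  have degU v : vdeg g v <= K' + (v \in U).
    by have := dK v; rewrite inE /K; case: eqP => /=; lia.
  have sumU (S : {set V}) : \sum_(v in S) vdeg g v <= K' * #|S| + #|U|.
    apply: leq_trans (_ : \sum_(v in S) (K' + (v \in U)) <= _); first exact: leq_sum.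
    rewrite big_split /= sum_nat_const mulnC leq_add2l -big_mkcondr /= sum1dep_card.
    by apply: subset_leq_card; apply/subsetP => v; rewrite !inE => /andP[].
  have wlow C : C \in F -> act -> vdeg g w <= cut g C.
    by case/oF => oC _ ac; have := lo C oC; move: ac; rewrite /act /K /=; lia.
  have [ac|nac] := boolP act; last first.
    have loF C : C \in F -> K' <= cut g C.
      by case/oF => oC _; have := lo C oC; move: nac; rewrite /act /K /=; lia.
    have := sum_cut_bound loF (leqnn #|[set C in F | cut g C < K']|).
    rewrite subnn muln0 addn0 => h1; have h2 := sumU T.
    have := leq_mul (leqnn K') TF; rewrite -addn2 mulnDr; lia.
  have [wT|wT] := boolP (w \in T).
    have wF C : C \in F -> w \notin C by move=> CF; rewrite (disjointFl (dF C CF)).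
    (* Two deficient members would be dominated from their complements, which together contain the
       slack of all vertices but [w]: more than their cuts allow. *)
    have b1 : #|[set C in F | cut g C < K']| <= 1.
      apply/card_le1_eqP => C1 C2; rewrite !inE => /andP[F1 c1] /andP[F2 c2].
      apply: contraTeq isT => n12.
      have [o1 _] := oF _ F1; have [o2 _] := oF _ F2.
      have e1 := exc C1 o1 (wF _ F1) c1; have e2 := exc C2 o2 (wF _ F2) c2.
      have s1 : slack g K.+1 (~: [set w]) = slack g K.+1 C1 + slack g K.+1 (~: C1 :\ w).
        rewrite -slackU; last first.
          by rewrite -setI_eq0; apply/eqP/setP => u; rewrite !inE; case: (u \in C1); rewrite ?andbF.
        congr slack; apply/setP => u; rewrite !inE; case: (u =P w) => [->|_] /=.
          by rewrite (negPf (wF _ F1)).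
        by case: (u \in C1).
      have s2 : slack g K.+1 C1 <= slack g K.+1 (~: C2 :\ w).
        apply: slackS; apply/subsetP => u uC; rewrite !inE; apply/andP; split.
          by apply: contraTneq uC => ->; apply: wF.
        by have := trivIsetP tF C2 C1 F2 F1 n12 => /disjointFl /(_ uC) ->.
      have := slK (~: [set w]); have := slKV w; have := cardsC1 w.
      by move: e1 e2 s1 s2 c1 c2 UK VK0; rewrite /K; clear; lia.
    have h1 := sum_cut_bound (fun C CF => wlow C CF ac) b1; rewrite mul1n in h1.
    move: sums TF; rewrite (big_setD1 w wT) (cardsD1 w T) wT add1n => h2 TF'.
    have h3 : vdeg g w <= K' by move: ac; rewrite /act /K; clear; lia.
    have TF2 : #|T :\ w| + 3 <= #|F| by rewrite addn3.
    have := barrier_count (sumU (T :\ w)) h2 h1 h3 TF2.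
    by move: UB; rewrite /K; clear; lia.
  (* The additional pairs at [w] force such a [C] to consist of vertices of degree [K]; then the
     side of [w] has too much slack to be dominated. *)
  have big C : C \in F -> w \notin C -> K <= cut g C.
    move=> CF wC; have [oC _] := oF C CF.
    have sub : ~: U \subset ~: C.
      apply/subsetP => v; rewrite !inE => dv; apply/negP => vC.
      have nvw : v != w by apply: contraNneq wC => <-.
      have vN : v \in N by rewrite inE nvw ltn_neqAle dv dK.
      have := cF C v w CF vC; rewrite /e ac eqxx vN orbT /= orbT => /(_ isT).
      by rewrite inE (negPf wC) (negPf wT).
    have [[v vE]|[v vE]|[C3 CC3]] := card_odd_cases oV oC.
    - have : v \in C by rewrite vE set11.
      have := subsetP sub v; rewrite !inE vE set11 /= => H' _; rewrite leqNgt; apply/negP => lt.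
      by have := H' _; rewrite neq_ltn; move: lt; rewrite /vdeg => -> /(_ isT).
    - by have := subset_leq_card sub; rewrite vE cards1; lia.
    - rewrite leqNgt; apply/negP => lt; have [Y [YC wY le]] := dom C oC C3 CC3 lt.
      case: YC wY le => -> wY le; first by rewrite wY in wC.
      have := leq_card_slack (~: C :\ w) dKS; have := subset_leq_card sub.
      by have := cardsD1 w (~: C); rewrite wY; lia.
  have b1 : #|[set C in F | cut g C < K]| <= 1.
    apply/card_le1_eqP => C1 C2; rewrite !inE => /andP[F1 c1] /andP[F2 c2].
    apply: contraTeq isT => n12.
    have w1 : w \in C1 by apply: contraLR c1 => /(big _ F1); rewrite -leqNgt.
    have w2 : w \in C2 by apply: contraLR c2 => /(big _ F2); rewrite -leqNgt.
    by have := trivIsetP tF C2 C1 F2 F1 n12 => /disjointFl /(_ w1); rewrite w2.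
  have h1 := sum_cut_bound (lo := 0) (fun _ _ => leq0n _) b1.
  have h2 : \sum_(t in T) vdeg g t <= K * #|T|.
    by rewrite mulnC -sum_nat_const; apply: leq_sum => v _; apply: dK.
  have := leq_mul (leqnn K) TF; rewrite -addn2 mulnDr; move: h1 h2 sums; rewrite mul1n subn0.
  by move: (K * _) (K * _) => p q; rewrite /K; lia.
have [M HM] := adj_matching g mK.
have nonadj v : ~~ adj g v (m' v) -> act && ((v == w) && (m' v \in N) || (m' v == w) && (v \in N)).
  by move=> nv; have := em v; rewrite /e (negPf nv).
apply: (@kcol_del _ _ _ M); first by move=> v; rewrite HM leq_b1.
have d' v : vdeg (del g M) v + adj g v (m' v) = vdeg g v by rewrite -HM; apply: cut_del.
apply: IH => //; last exact: good_del.
  move=> v; have := d' v; have := dK v; case: (boolP (adj g v (m' v))) => [_|/nonadj]; first by rewrite /K; lia.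
  case/andP=> ac /orP[/andP[/eqP-> _]|/andP[_]]; first by move: ac; rewrite /act /K; lia.
  by rewrite inE => /andP[_]; rewrite /K; lia.
(* A vertex of degree [K'] now either had degree [K] or was missed by [M]; besides [w], only [m' w]
   can be missed. *)
have sub : [set v | vdeg (del g M) v == K'] \subset m' w |: U.
  apply/subsetP => v; rewrite !inE; have := d' v.
  case: (boolP (adj g v (m' v))) => [_|/nonadj]; first by rewrite /K; lia.
  case/andP=> ac /orP[/andP[/eqP-> _]|/andP[/eqP <- _]]; first by move: ac; rewrite /act /K; lia.
  by rewrite mK eqxx.
have := subset_leq_card sub; rewrite cardsU1; move: UK; rewrite /K; case: (_ \notin U) => /=; lia.
Qed.

(* Perfect matchings exist as long as [m < 3 * r]; from then on the second spare colour is used. *)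
Lemma kcol_one_spare r (V E : finType) (g : E -> V * V) :
    (m < 3 * r -> m = n) -> (forall v, vdeg g v <= r) -> slack g r.+1 [set: V] <= n ->
    ~~ odd #|V| -> good g r.+1 ->
  kcol g (r.+1 + J.+1).
Proof.
(* One of the [J.+1] extra colours becomes the second spare colour; at the start no vertex has used
   it. *)
have switch r0 (W D : finType) (h : D -> W * W) : 3 * r0 <= m -> (forall v, vdeg h v <= r0) ->
    ~~ odd #|W| -> good h r0.+1 -> kcol h (r0.+1 + J.+1).
  move=> rm dr oV G; rewrite addnS -addSn.
  apply: (@kcol_two_spare r0.+1 r0.+1) => //; first by rewrite mulnS addnC leq_add2r.
  - by move=> v; apply: leqW.
  - rewrite (_ : [set v | _] = set0) ?cards0 //.
    by apply/setP => v; rewrite !inE ltn_eqF // ltnS.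
  - exact: good_leq G.
elim: r V E g => [|r' IH] V E g mn dr sn oV G; first by apply: switch; rewrite ?muln0.
have [rm|rm] := leqP (3 * r'.+1) m; first exact: switch.
have {}mn : m = n by apply: mn.
pose r := r'.+1.
pose Inv (V E : finType) (g : E -> V * V) := (forall v, vdeg g v <= r) /\ slack g r.+1 [set: V] <= n.
have I : Inv V E g by [].
move: I oV G; clear dr sn; move: V E g.
(* Margin and threshold 2 keep all degrees at most [r]; at the end every vertex but [w] has degree
   exactly [r]. *)
apply: (@normalise Inv 2 2 r.+1 (r.+1 + J.+1)) => //.
- move=> V E g Z [dr sn] oV G oZ C3 cs; split.
    case=> [u|]; first by rewrite vdeg_contract_Some.
    by rewrite vdeg_contract_None; lia.
  apply: leq_trans sn; rewrite slack_contract -(slackC g _ Z) addnC leq_add2l.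
  by have := G.2 (~: Z); rewrite cutC odd_compl // => /(_ oZ); lia.
- move=> V E g a b [dr sn] nab ta tb; split.
    move=> v; rewrite deg_addE //; have := dr v.
    case: (v =P a) => [->|_]; first by rewrite (negPf nab); lia.
    by case: (v =P b) => [->|_]; lia.
  by apply: leq_trans sn; rewrite -(@slack_addE _ _ g a b) //; lia.
move=> V E g w [dr sn] oV G irr H.
have [Vm|Vm] := leqP (3 * #|V|) (2 * m); first exact: kcol_part1.
have dw v : v != w -> vdeg g v = r by move=> /H; have := dr v; lia.
have dlt v : vdeg g v < r.+1 by have := dr v; lia.
have sw (X : {set V}) : w \in X -> r - vdeg g w + #|X| <= slack g r.+1 X.
  move=> wX; rewrite (slackD1 g _ wX); have := leq_card_slack (X :\ w) dlt.
  by have := cardsD1 w X; rewrite wX; have := dr w; lia.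
have dwn : r - vdeg g w + #|V| <= n.
  by apply: leq_trans sn; rewrite -cardsT; apply: sw; rewrite inE.
have trich (C : {set V}) : odd #|C| -> [\/ r <= cut g C, w \in C /\ vdeg g w + #|C| <= (cut g C).+1
    | w \notin C /\ vdeg g w + #|~: C| <= (cut g C).+1].
  move=> oC; have [[v vE]|[v vE]|[C3 CC3]] := card_odd_cases oV oC.
  - have [vw|/dw dv] := eqVneq v w; last by constructor 1; rewrite vE -/(vdeg g v) dv.
    by constructor 2; rewrite vE vw set11 cards1 addn1.
  - have [vw|/dw dv] := eqVneq v w; last by constructor 1; rewrite -cutC vE -/(vdeg g v) dv.
    by constructor 3; rewrite -in_setC vE vw set11 cards1 addn1 -cutC vE vw.
  - have [rc|cr] := leqP r (cut g C); first by constructor 1.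
    have [| |v [Y [YC vY lt]]] := irreducible_dominated G oV irr oC C3 CC3; try lia.
    have lY := leq_card_slack (Y :\ v) dlt.
    have vw : v = w by have [//|/dw dv] := eqVneq v w; lia.
    have cY := cardsD1 v Y; rewrite vY in cY; rewrite vw in vY lt lY cY.
    case: YC vY lt lY cY => -> vY lt lY cY.
      by constructor 2; split=> //; lia.
    by constructor 3; split; [rewrite -in_setC|lia].
(* Here [r - vdeg g w <= m - #|V| < m / 3], while [#|V|] exceeds [2 * m / 3]. *)
have gap : r.*2 - (vdeg g w).*2 < #|V| by lia.
have [[m' [mK em]]|[T [F [[tF oF cF _] TF]]]] := tutte_barrier (@adj_sym V _ g) (@adj_irr V _ g) oV; last first.
  have dF C : C \in F -> [disjoint C & T] by move=> /oF[].
  have sums := barrier_cuts tF dF cF.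
  have loF C : C \in F -> vdeg g w <= cut g C.
    move=> CF; have [oC _] := oF C CF; have := trich C oC; have := dr w.
    have : 0 < #|C| by case: #|C| oC.
    have : 0 < #|~: C| by rewrite -(odd_compl C oV) in oC; case: #|~: C| oC.
    by move=> ? ? ? [|[]|[]]; lia.
  (* One deficient member may contain [w]. Two avoiding [w] would have disjoint small complements
     covering too few vertices: [#|V| <= 2 * (r - vdeg g w)], against [gap]. *)
  have b2 : #|[set C in F | cut g C < r]| <= 2.
    rewrite -(cardsID [set C : {set V} | w \in C]) -[2]/(1 + 1); apply: leq_add.
      apply/card_le1_eqP => C1 C2; rewrite !inE => /andP[/andP[F1 _] w1] /andP[/andP[F2 _] w2].
      apply: contraTeq isT => n12.
      by have := trivIsetP tF C2 C1 F2 F1 n12 => /disjointFl /(_ w1); rewrite w2.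
    apply/card_le1_eqP => C1 C2; rewrite !inE => /andP[w1 /andP[F1 c1]] /andP[w2 /andP[F2 c2]].
    apply: contraTeq isT => n12.
    have [o1 _] := oF _ F1; have [o2 _] := oF _ F2.
    have l1 : vdeg g w + #|~: C1| <= r.
      by case: (trich C1 o1) => [|[]|[_]]; [lia|rewrite (negPf w1)|lia].
    have l2 : vdeg g w + #|~: C2| <= r.
      by case: (trich C2 o2) => [|[]|[_]]; [lia|rewrite (negPf w2)|lia].
    have : #|C1| <= #|~: C2|.
      apply: subset_leq_card; apply/subsetP => u uC; rewrite inE.
      by have := trivIsetP tF C2 C1 F2 F1 n12 => /disjointFl /(_ uC) ->.
    by have := cardsC C1; lia.
  have h1 := sum_cut_bound loF b2.
  have h2 : \sum_(t in T) vdeg g t <= r * #|T|.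
    by rewrite mulnC -sum_nat_const; apply: leq_sum => v _; apply: dr.
  have h3 := leq_mul (leqnn r) TF; rewrite -addn2 mulnDr in h3.
  (* The count leaves only [vdeg g w = 0], and then [dwn] contradicts [m < 3 * r]. *)
  by move: h1 h2 h3 sums rm mn dwn Vm; rewrite -/r; clear; lia.
have [M HM] := adj_matching g mK.
have {em}HM v : #|M :&: bd g [set v]| = 1 by rewrite HM em.
rewrite addSn; apply: (@kcol_del _ _ _ M); first by move=> v; rewrite HM.
have d' v : (vdeg (del g M) v).+1 = vdeg g v by rewrite -addn1 -(HM v); apply: cut_del.
have sl X : slack (del g M) r X = slack g r.+1 X.
  by apply: eq_bigr => v _; rewrite -d' subSS.
apply: IH => //.
- by move=> v; have := d' v; have := dr v; rewrite /r; lia.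
- by rewrite -/r sl.
split=> [v|X oX]; first by have := d' v; have := dr v; rewrite -/r; lia.
rewrite -/r sl; have cX := cut_del g M X; have mX := cardI_bd g X M.
have mCX := cardI_bd g (~: X) M; rewrite bdC in mCX.
move: mX mCX; under eq_bigr => v _ do rewrite HM.
under [X in _ -> _ <= X -> _]eq_bigr => v _ do rewrite HM.
rewrite !sum1_card => mX mCX.
have lX := leq_card_slack X dlt.
have [rc|cr] := leqP r (cut g X); first by lia.
have dw0 := dr w; have VX := cardsC X.
have [|[wX le]|[wX le]] := trich X oX; first by lia.
  by have := sw X wX; lia.
(* The cut loses at most [#|~: X|] edges and the slack is at least [#|X|]; [gap] supplies the
   rest. *)
by lia.
Qed.

End Stage.

(** Normalising makes the multigraph [k]-regular. Of the two extra colours, the first gives every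
    vertex one spare colour, and the second is left to [kcol_one_spare]. *)
Theorem excess_bound_log J : excess_bound J.
Proof.
elim/ltn_ind: J => J IH V E g k G oV lt.
have mono a b : a <= b -> kcol g a -> kcol g b.
  move=> ab [c Hc]; exists c => v e ev; have [le inj] := Hc v e ev.
  by split=> //; apply: leq_trans ab.
have [small|] := boolP ((#|V| <= 8) || (k <= 2)).
  by apply: mono (leq_addr J k) _; apply: kcol_small.
rewrite negb_or -!ltnNge => /andP[V8 k2].
pose n := #|V|; pose m := minn n (3 * k).
have m9 : 9 <= m by rewrite leq_min V8; lia.
(* For [J <= 1] the bound forces [m <= 6], against [m9]. *)
case: J IH lt => [|[|J]] IH lt; try by move: lt; rewrite -/n -/m !expnS expn0; lia.
have HA0 : excess_bound J by apply: IH.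
have HA1 : excess_bound J.+1 by apply: IH.
have mJ : m * 2 ^ J.+3 < 3 ^ J.+4 by exact: lt.
have mn : m < 3 * k -> m = n by move: (minnE n (3 * k)); rewrite /m; clear; lia.
move: (m) (n) (leqnn n : #|V| <= n) mn m9 mJ => m1 n1 Vn mn m9' mJ.
pose Inv (V E : finType) (_ : E -> V * V) := #|V| <= n1 : Prop.
have I : Inv V E g by [].
move: I oV G; clear - HA0 HA1 mn m9' mJ Inv; move: V E g.
have -> : k + J.+2 = k.+1 + J.+1 by rewrite addnS addSn.
apply: (@normalise Inv 0 1 k (k.+1 + J.+1)) => //.
- move=> V E g Z; rewrite /Inv => Vn oV G oZ C3 _; apply: leq_trans Vn.
  rewrite card_option card_sig; have -> : #|[pred x in Z]| = #|Z| by [].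
  by have := cardsC Z; lia.
move=> V E g w Vn oV G _ H.
have reg := regular_of_saturated G oV H.
apply: (kcol_one_spare HA0 HA1 m9' mJ mn) => //; last exact: good_leq G.
- by move=> v; rewrite reg.
- apply: leq_trans Vn; rewrite /slack (eq_bigr (fun=> 1)) => [|v _]; last by rewrite reg subSnn.
  by rewrite sum1_card cardsT.
Qed.

(** * The bound for multigraphs *)

Section AddVertex.
Variables (V E : finType) (g : E -> V * V).

Definition add_vertex : E -> option V * option V := fun e => (Some (g e).1, Some (g e).2).

Lemma bd_add_vertex X : bd add_vertex X = bd g (Some @^-1: X).
Proof. by apply/setP => e; rewrite !inE. Qed.

Lemma preim_Some1 (v : V) : Some @^-1: [set Some v] = [set v].
Proof. by apply/setP => u; rewrite !inE. Qed.

Lemma bd_add_vertex_Some v : bd add_vertex [set Some v] = bd g [set v].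
Proof. by rewrite bd_add_vertex preim_Some1. Qed.

Lemma sum_set_option (F : option V -> nat) (X : {set option V}) :
  \sum_(x in X) F x = (None \in X) * F None + \sum_(v in Some @^-1: X) F (Some v).
Proof.
rewrite (bigID (pred1 None)) /=; congr addn.
  case: (boolP (None \in X)) => NX; last first.
    by rewrite big1 // => x /andP[xX /eqP xN]; rewrite xN (negPf NX) in xX.
  by rewrite mul1n (big_pred1 None) // => x /=; case: (x =P None) => [->|_]; rewrite ?NX ?andbF.
rewrite (reindex_omap Some id) /=; last by case=> [v|]; rewrite ?andbF.
by apply: eq_bigl => v; rewrite !inE eqxx !andbT.
Qed.

(** A set containing the isolated vertex has slack at least [k] from it alone. *)
Lemma good_add_vertex k : good g k -> good add_vertex k.
Proof.
move=> [dk gk]; split=> [[v|]|X oX]; rewrite /vdeg /cut.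
- by rewrite bd_add_vertex_Some; apply: dk.
- rewrite bd_add_vertex (_ : _ @^-1: _ = set0); last by apply/setP => v; rewrite !inE.
  by rewrite (_ : bd g set0 = set0) ?cards0 //; apply/setP => e; rewrite !inE.
have dS v : vdeg add_vertex (Some v) = vdeg g v by rewrite /vdeg /cut bd_add_vertex_Some.
have dN : vdeg add_vertex None = 0.
  rewrite /vdeg /cut bd_add_vertex (_ : _ @^-1: _ = set0); last by apply/setP => v; rewrite !inE.
  by rewrite (_ : bd g set0 = set0) ?cards0 //; apply/setP => e; rewrite !inE.
rewrite bd_add_vertex /slack sum_set_option dN subn0.
have [NX|NX] := boolP (None \in X); first by lia.
rewrite mul0n add0n; under eq_bigr => v _ do rewrite dS.
apply: gk; move: oX; rewrite -sum1_card sum_set_option (negPf NX) mul0n add0n.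
by rewrite sum1_card.
Qed.

Lemma kcol_add_vertex k : kcol add_vertex k -> kcol g k.
Proof.
move=> [c Hc]; exists c => v e ev; have [] := Hc (Some v) e; first by rewrite bd_add_vertex_Some.
by move=> lt inj; split=> // f fv; apply: inj; rewrite bd_add_vertex_Some.
Qed.

End AddVertex.

(** * From degrees and densities to goodness, and from [kcol] to the chromatic index *)

Section Multigraphs.
Variables (V E : finType) (eu ew : E -> V).
Hypothesis loopless : forall e, eu e != ew e.

Let g e := (eu e, ew e).

Lemma in_bd_incident v e : (e \in bd g [set v]) = incident eu ew e v.
Proof.
rewrite in_bd1 /= loopless /incident /=.
by rewrite [v == _]eq_sym [v == ew e]eq_sym.
Qed.

Lemma vdeg_deg v : vdeg g v = deg eu ew v.
Proof. by apply: eq_card => e; rewrite in_bd_incident inE. Qed.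

Lemma sum_deg_le (X : {set V}) : \sum_(v in X) vdeg g v <= cut g X + (e_ind eu ew X).*2.
Proof.
have -> : cut g X = \sum_e (e \in bd g X) by rewrite -big_mkcond sum1_card.
have -> : e_ind eu ew X = \sum_e ((eu e \in X) && (ew e \in X)).
  by rewrite -big_mkcond sum1dep_card.
rewrite -addnn -!big_split /=.
under eq_bigr => v _ do rewrite /vdeg /cut -sum1_card big_mkcond.
rewrite exchange_big /=; apply: leq_sum => e _.
apply: leq_trans (_ : \sum_(v in X) ((v == eu e) + (v == ew e)) <= _).
  apply: leq_sum => v _; rewrite in_bd_incident /incident ![_ == v]eq_sym.
  by case: (v == _); case: (v == _).
by rewrite big_split /= !sum_eq_mem inE /=; case: (_ \in X); case: (_ \in X).
Qed.

(** Degree sum plus slack is [k * #|X|]; subtracting [2 * e_ind] leaves at least [k] for cut plus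
    slack. Singletons are tight. *)
Lemma good_of_density k : (forall v, deg eu ew v <= k) ->
    (forall S : {set V}, odd #|S| -> 3 <= #|S| -> 2 * e_ind eu ew S <= k * (#|S| - 1)) ->
  good g k.
Proof.
move=> dk ek; have dk' v : vdeg g v <= k by rewrite vdeg_deg.
split=> // X oX; have := slackE X dk'; have := sum_deg_le X.
have [/eqP/cards1P[v vE]|X1] := eqVneq #|X| 1.
  by rewrite vE slack1 /vdeg; have := dk' v; rewrite /vdeg; lia.
have X3 : 3 <= #|X| by move: oX X1; case: #|X| => [|[|[|a]]].
have := ek X oX X3; rewrite mulnBr muln1.
have : k <= k * #|X| by rewrite leq_pmulr //; lia.
by lia.
Qed.

Lemma chromatic_index_le k : kcol g k -> chromatic_index eu ew <= k.
Proof.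
move=> [c Hc]; rewrite /chromatic_index; case: ex_minnP => i _; apply.
have ends e : e \in bd g [set eu e] by rewrite in_bd_incident /incident eqxx.
have ck e : c e < k by have [] := Hc _ _ (ends e).
apply/colourableP; exists (fun e => Ordinal (ck e)) => e f nef [cef].
apply/existsP => -[v /andP[]]; rewrite -!in_bd_incident => ev fv.
by have [_ inj] := Hc v e ev; rewrite (inj f fv cef) eqxx in nef.
Qed.

Lemma chromatic_index_bound k J n : good g k -> n = (if odd #|V| then #|V|.+1 else #|V|) ->
  minn n (3 * k) * 2 ^ J.+1 < 3 ^ J.+2 -> chromatic_index eu ew <= k + J.
Proof.
move=> G -> lt; apply: chromatic_index_le.
case: ifP lt => [oV|/negbT oV] lt; last exact: excess_bound_log.
apply: kcol_add_vertex; apply: excess_bound_log; rewrite ?card_option //= ?oV //.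
exact: good_add_vertex.
Qed.

End Multigraphs.

(** [J] is the floor of the logarithm of [m / 3] to base [3/2]; [lin] bounds the search for it. *)
Lemma log32_floor m : 3 <= m -> exists J, 3 ^ J.+1 <= m * 2 ^ J /\ m * 2 ^ J.+1 < 3 ^ J.+2.
Proof.
move=> m3.
have lin j : j * 2 ^ j < 3 ^ j.+1.
  elim: j => // j IH; have : 2 ^ j <= 3 ^ j by case: j {IH} => // j; rewrite leq_exp2r.
  by move: IH; rewrite !expnS; nia.
have ex0 : exists j, 3 ^ j.+1 <= m * 2 ^ j by exists 0; rewrite muln1.
have bnd j : 3 ^ j.+1 <= m * 2 ^ j -> j <= m.
  move=> le; rewrite leqNgt; apply/negP => mj.
  by have := leq_ltn_trans (leq_mul (ltnW mj) (leqnn (2 ^ j))) (lin j); rewrite ltnNge le.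
case: (ex_maxnP ex0 bnd) => J PJ Jmax; exists J; split=> //.
by rewrite ltnNge; apply/negP => /Jmax; rewrite ltnn.
Qed.


From Stdlib Require Import Reals Lra.

(** * Real inequalities and logarithms *)

Section Reals.
Open Scope R_scope.

Lemma le_bigRmax (I : finType) (P : pred I) (F : I -> R) i : P i ->
  F i <= \big[Rmax/0]_(j | P j) F j.
Proof.
move=> Pi; have: i \in index_enum I by rewrite mem_index_enum.
elim: (index_enum I) => // j s IH; rewrite inE big_cons => /orP[/eqP <-|/IH le].
  by rewrite Pi; apply: Rmax_l.
by case: ifP => _ //; apply: Rle_trans le (Rmax_r _ _).
Qed.

Lemma leq_INR a b : leq a b -> INR a <= INR b.
Proof. by move/leP; apply: le_INR. Qed.

Lemma INR_leq a b : INR a <= INR b -> leq a b.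
Proof. by move/INR_le/leP. Qed.

Lemma INR_expn a b : INR (expn a b) = INR a ^ b.
Proof. by elim: b => [|b IH] //=; rewrite expnS mult_INR IH. Qed.

Lemma le_log32 J x : (3 / 2) ^ J <= x -> INR J <= log32 x.
Proof.
move=> le; have l0 : 0 < ln (3/2) by rewrite -ln_1; apply: ln_increasing; lra.
have p0 : 0 < (3 / 2) ^ J by apply: pow_lt; lra.
rewrite /log32; apply: (Rmult_le_reg_r (ln (3/2))) => //.
rewrite /Rdiv Rmult_assoc Rinv_l ?Rmult_1_r; last lra.
rewrite -ln_pow; last lra.
by case: le => [lt|<-]; [left; apply: ln_increasing|right].
Qed.

Lemma pow32_le J a b : leq (expn 3 J.+1) (muln a (expn 2 J)) -> INR a = 3 * b -> (3 / 2) ^ J <= b.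
Proof.
move/leq_INR; rewrite mult_INR !INR_expn => H ab.
have p2 : 0 < 2 ^ J by apply: pow_lt; lra.
rewrite Rpow_mult_distr pow_inv; apply: (Rmult_le_reg_r (2 ^ J)) => //.
rewrite Rmult_assoc Rinv_l; last lra.
have i3 : INR 3 = 3 by rewrite /=; lra.
have i2 : INR 2 = 2 by [].
move: H; rewrite ab i3 i2 -tech_pow_Rmult.
by move: (3 ^ J) (2 ^ J) => p q ?; nra.
Qed.

End Reals.

Theorem theorem1 (V E : finType) (eu ew : E -> V)
  (Hloopless : forall e : E, eu e != ew e)
  (Horder : (3 <= #|V|)%N) (Hedge : (0 < #|E|)%N) :
  let n := #|V| in
  let ph := IZR (phi eu ew) in
  (INR (chromatic_index eu ew) <=
     ph + log32 (Rmin (if odd n then (INR n + 1) / 3 else INR n / 3) ph))%R.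
Proof.
move=> n ph.
have chi_ph : (chi_f eu ew <= ph)%R.
  rewrite /ph /phi /Rceil opp_IZR; have [] := base_Int_part (- chi_f eu ew); lra.
have Dph : (INR (maxdeg eu ew) <= ph)%R by apply: Rle_trans chi_ph; apply: Rmax_l.
have Gph : (Gamma eu ew <= ph)%R by apply: Rle_trans chi_ph; apply: Rmax_r.
have [k kph] : exists k, INR k = ph.
  have [|k kE] := IZN (phi eu ew); last by exists k; rewrite /ph kE INR_IZR_INZ.
  by apply: le_IZR; apply: Rle_trans Dph; apply: pos_INR.
have dk v : deg eu ew v <= k.
  apply: leq_trans (_ : maxdeg eu ew <= k); first exact: (leq_bigmax v).
  by apply: INR_leq; rewrite kph.
(* An edge makes [k] positive, so that [minn n' (3 * k)] reaches 3 and its floor logarithm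
   exists. *)
have k0 : 0 < k.
  move: Hedge; rewrite -cardsT card_gt0 => /set0Pn[e _].
  apply: leq_trans (dk (eu e)); rewrite card_gt0; apply/set0Pn; exists e.
  by rewrite inE /incident eqxx.
have G : good (fun e => (eu e, ew e)) k.
  apply: good_of_density => // S oS S3; apply: INR_leq.
  have tS : (t_ind eu ew S <= INR k)%R.
    rewrite kph; apply: Rle_trans Gph.
    by apply: (le_bigRmax (P := fun S : {set V} => odd #|S| && leq 3 #|S|)); rewrite oS.
  rewrite !mult_INR; set d := (#|S| - 1)%N.
  have d0 : (0 < INR d)%R by apply: lt_0_INR; apply/ltP; rewrite subn_gt0; apply: leq_trans S3.
  move: tS; rewrite /t_ind -/d => tS.
  have -> : (INR 2 * INR (e_ind eu ew S) = 2 * INR (e_ind eu ew S) / INR d * INR d)%R.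
    by rewrite /=; field; lra.
  by apply: Rmult_le_compat_r => //; lra.
(* [n'] counts the isolated vertex added for odd order, so [n' / 3] is the first argument of [Rmin]
   for either parity. *)
pose n' := if odd #|V| then #|V|.+1 else #|V|.
have m3 : 3 <= minn n' (3 * k).
  by rewrite leq_min /n'; case: ifP => _; lia.
have [J [J1 J2]] := log32_floor m3.
have := chromatic_index_bound Hloopless G (erefl n') J2 => /leq_INR le.
apply: Rle_trans le _; rewrite plus_INR kph; apply: Rplus_le_compat_l.
apply: le_log32; apply: Rmin_glb.
  have -> : (if odd n then (INR n + 1) / 3 else INR n / 3)%R = (INR n' / 3)%R.
    by rewrite /n' /n; case: ifP => _ //; rewrite S_INR.
  apply: (@pow32_le _ n'); last by field.
  by apply: leq_trans J1 _; rewrite leq_mul2r geq_minl orbT.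
rewrite -kph; apply: (@pow32_le _ (3 * k)); last by rewrite mult_INR /=; lra.
by apply: leq_trans J1 _; rewrite leq_mul2r geq_minr orbT.
Qed.
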